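(* Let $n\ge 2$. A functional $\Psi:\mathcal{P}^n_0 \to \mathbb{R}$ is an $\mathrm{SL}(n)$ invariant valuation if and only if there are constants $c_0,c_0'\in\mathbb{R}$ and a solution $\psi:[0,\infty)\to \mathbb{R}$ of Cauchy's functional equation such that $$\Psi (P)= c_0\,V_0(P) + c_0' \,(-1)^{\dim P}\, \mathbf{1}_{\operatorname{relint} P} (0) + \psi\big(V_n(P)\big)$$ for every $P\in\mathcal{P}^n_0$.
   Context: $\mathcal{P}^n_0$ is the set of convex polytopes in $\mathbb{R}^n$ that contain the origin $0$. A functional $\Psi:\mathcal{S}\to\mathbb{R}$ on a collection $\mathcal{S}$ of sets is a valuation if $\Psi(P)+\Psi(Q)=\Psi(P\cup Q)+\Psi(P\cap Q)$ whenever $P,Q,P\cap Q,P\cup Q\in\mathcal{S}$. It is $\mathrm{SL}(n)$ invariant if $\Psi(AP)=\Psi(P)$ for every $A\in\mathrm{SL}(n)$ (the real $n\times n$ matrices of determinant $1$) and $P\in\mathcal{S}$. $V_n$ is $n$-dimensional volume and $V_0$ is the Euler characteristic, i.e. $V_0(P)=1$ for every nonempty polytope $P$. $\dim P$ is the dimension of the affine hull of $P$, $\operatorname{relint} P$ is the interior of $P$ relative to its affine hull, and $\mathbf{1}_Q$ is the indicator function of $Q\subset\mathbb{R}^n$. A function $\psi:[0,\infty)\to\mathbb{R}$ is a solution of Cauchy's functional equation if $\psi(x+y)=\psi(x)+\psi(y)$ for all $x,y\in[0,\infty)$; no regularity is assumed. *)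

(* Defs.v *)
From HB Require Import structures.
From mathcomp Require Import all_boot all_order all_algebra.
From mathcomp Require Import all_classical all_reals all_analysis.

Set Implicit Arguments.
Unset Strict Implicit.
Unset Printing Implicit Defensive.

Import Order.TTheory GRing.Theory Num.Theory.
Import numFieldNormedType.Exports.

Local Open Scope classical_set_scope.
Local Open Scope ring_scope.

Section lebesgue_tuple.
Context (R : realType).
Local Notation mR := (measurableTypeR R).

Definition tcons n (p : mR * n.-tuple mR) : n.+1.-tuple mR :=
  [the n.+1.-tuple mR of p.1 :: p.2].

(* n-dimensional Lebesgue measure, as the n-fold product of the Lebesgue measure
   on the line. *)
Fixpoint lebesgue_tuple (n : nat) : set (n.-tuple mR) -> \bar R :=
  if n is m.+1 then
    pushforward (@lebesgue_measure R \x @lebesgue_tuple m)%E (@tcons m)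
  else \d_ [tuple].

Lemma measurable_tcons n : measurable_fun setT (@tcons n).
Proof. exact: measurable_cons measurable_fst measurable_snd. Qed.

Definition box n (I : 'I_n -> set mR) : set (n.-tuple mR) :=
  [set t | forall i, I i (tnth t i)].

Lemma measurable_box n (I : 'I_n -> set mR) :
  (forall i, measurable (I i)) -> measurable (box I).
Proof.
move=> mI; have -> : box I = \bigcap_(i in [set: 'I_n]) ((@tnth n mR)^~ i @^-1` I i).
  by apply/seteqP; split=> [t It i _|t It i]; exact: It.
apply: fin_bigcap_measurable => // i _; rewrite -[X in measurable X]setTI.
exact: measurable_tnth.
Qed.

Lemma tcons_box n (I : 'I_n.+1 -> set mR) :
  @tcons n @^-1` box I = I ord0 `*` box (fun i => I (lift ord0 i)).
Proof.
apply/seteqP; split=> -[x t] /=.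
  move=> It; split=> [|i]; first exact: (It ord0).
  by have := It (lift ord0 i); rewrite tnthS.
move=> [Ix It] i; case: (unliftP ord0 i) => [j|] ->; last exact: Ix.
by rewrite tnthS; exact: It.
Qed.

Lemma lebesgue_tuple_measure n :
  exists mu : {sigma_finite_measure set (n.-tuple mR) -> \bar R},
    @lebesgue_tuple n = mu.
Proof.
elim: n => [|n [mu muE]]; first by exists (\d_ ([tuple] : 0.-tuple mR)).
pose nu1 : {measure set (n.+1.-tuple mR) -> \bar R} :=
  measure_function_pushforward__canonical__measure_function_Measure
    (@lebesgue_measure R \x mu)%E (@measurable_tcons n).
have nu1E : @lebesgue_tuple n.+1 = nu1 by rewrite /= muE.
have nu1sf : sigma_finite setT nu1.
  have /sigma_finiteP[F [FT Fnd Ffin]] := sigma_finiteT (@lebesgue_measure R).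
  have /sigma_finiteP[G [GT Gnd Gfin]] := sigma_finiteT mu.
  pose H k := [set t : n.+1.-tuple mR | F k (thead t) /\ G k [tuple of behead t]].
  have HE k : @tcons n @^-1` H k = F k `*` G k.
    apply/seteqP; split=> -[x t]; rewrite /H /tcons /= theadE.
      by move=> [Fx Gt]; split=> //; congr (G k _): Gt; exact/val_inj.
    by move=> [Fx Gt]; split=> //; congr (G k _): Gt; exact/val_inj.
  exists H => [|k].
    apply/esym; rewrite -subTset => t _.
    have [i _ Fi] : (\bigcup_i F i) (thead t) by rewrite -FT.
    have [j _ Gj] : (\bigcup_i G i) [tuple of behead t] by rewrite -GT.
    exists (maxn i j) => //; split.
      by have /subsetPset := Fnd _ _ (leq_maxl i j); exact.
    by have /subsetPset := Gnd _ _ (leq_maxr i j); exact.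
  split.
    have -> : H k = (@tnth n.+1 mR)^~ ord0 @^-1` F k `&`
        (fun t : n.+1.-tuple mR => [tuple of behead t]) @^-1` G k by [].
    apply: measurableI; rewrite -[X in measurable X]setTI.
      by apply: measurable_tnth => //; exact: (Ffin k).1.
    by apply: measurable_behead => //; exact: (Gfin k).1.
  rewrite /= /pushforward HE product_measure1E; [|exact: (Ffin k).1|exact: (Gfin k).1].
  by apply: lte_mul_pinfty => //; [rewrite ge0_fin_numE//; exact: (Ffin k).2|exact: (Gfin k).2].
pose H1 := Measure_isSigmaFinite.Build _ _ _ nu1 nu1sf.
pose nu : {sigma_finite_measure set (n.+1.-tuple mR) -> \bar R} := HB.pack (Measure.sort nu1) H1.
by exists nu.
Qed.

Lemma lebesgue_tuple_box n (I : 'I_n -> set mR) :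
  (forall i, measurable (I i)) ->
  (lebesgue_tuple (box I) = \prod_(i < n) @lebesgue_measure R (I i))%E.
Proof.
elim: n I => [|n IH] I mI.
  by rewrite big_ord0 /= diracE mem_set// => -[].
have [mu muE] := lebesgue_tuple_measure n.
rewrite big_ord_recl -IH// /= /pushforward tcons_box muE product_measure1E//.
exact: measurable_box.
Qed.

End lebesgue_tuple.

Section polytopes.
Context (R : realType) (n : nat).
Local Notation V := 'cV[R]_n.
Implicit Types (A P : set V) (x : V).

Definition conv_hull A : set V :=
  [set x | exists (k : nat) (v : 'I_k -> V) (a : 'I_k -> R),
    [/\ forall i, A (v i), forall i, 0 <= a i, \sum_(i < k) a i = 1
      & x = \sum_(i < k) a i *: v i]].

Definition aff_hull A : set V :=
  [set x | exists (k : nat) (v : 'I_k -> V) (a : 'I_k -> R),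
    [/\ forall i, A (v i), \sum_(i < k) a i = 1
      & x = \sum_(i < k) a i *: v i]].

Definition polytope P := exists s : seq V, P = conv_hull [set` s].

Definition polytope0 P := polytope P /\ P 0.

(* For A nonempty, aff_hull A is a translate of exactly one linear subspace W,
   and the dimension of A is that of W; the default value 0 is only reached for
   A empty. *)
Definition aff_dim A : nat :=
  xget 0%N [set d | exists x (W : {vspace V}),
    aff_hull A = [set x + w | w in [set` W]] /\ \dim W = d].

Definition relint P : set V := ((P : set (subspace (aff_hull P)))°).

Definition volume P : R :=
  fine (lebesgue_tuple [set t | P (\col_(i < n) tnth t i)]).

Definition euler_char P : R := `[< P !=set0 >]%:R.

(* A functional on a class S of sets is represented by a function on all sets,
   of which only the values on S matter. *)
Definition valuation (S : set (set V)) (Psi : set V -> R) :=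
  forall P Q, S P -> S Q -> S (P `&` Q) -> S (P `|` Q) ->
    Psi P + Psi Q = Psi (P `|` Q) + Psi (P `&` Q).

Definition SL_invariant (S : set (set V)) (Psi : set V -> R) :=
  forall (A : 'M[R]_n) P, \det A = 1 -> S P -> Psi (mulmx A @` P) = Psi P.

End polytopes.

Definition cauchy_solution (R : realType) (psi : R -> R) :=
  forall x y : R, 0 <= x -> 0 <= y -> psi (x + y) = psi x + psi y.

(* Main.v *)
(* Up to SL(n), a simplex with vertex 0 is determined by its dimension, together
   with its volume when it is full-dimensional. Splitting such a simplex by a
   hyperplane through 0 shows that an invariant valuation takes one common value
   c0 in the dimensions 1, ..., n - 1 and the value c0 + psi(V_n), psi additive,
   in dimension n. Subtracting the functional with these c0 and psi and with
   c0' = Psi({0}) - c0 leaves a valuation that vanishes on all simplices with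
   vertex 0. It vanishes on S /\ K for every such simplex S and every finite
   intersection K of half-spaces {l <= d}, d >= 0, by induction on their number: a
   half-space is removed by cutting S through 0 along edges that cross l = d, until
   each piece has all its nonzero vertices on one side. Cutting a polytope along the
   coordinate hyperplanes brings every piece into this form.
   For the converse, (-1)^dim P 1_{relint P}(0) depends only on the cone C
   generated by P, and is nonzero only if C is a subspace. If C and D are
   incomparable closed cones with convex union, neither is a subspace, and C \/ D is
   a subspace iff C /\ D is, of one dimension less. *)
Require Import Defs.
From HB Require Import structures.
From mathcomp Require Import all_boot all_order all_algebra.
From mathcomp Require Import all_classical all_reals all_analysis.
From mathcomp Require Import ring lra.

Set Implicit Arguments.
Unset Strict Implicit.
Unset Printing Implicit Defensive.

Import Order.TTheory GRing.Theory Num.Theory.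
Import numFieldNormedType.Exports.

Local Open Scope classical_set_scope.
Local Open Scope ring_scope.

(** * Finitely generated hulls and half-spaces *)

Section hulls.
Context (R : realType) (n : nat).
Local Notation V := 'cV[R]_n.
Implicit Types (s r : seq V) (x y u v : V) (a b c d e : R).

(* The points sum_i a_i s_i with all a_i >= 0 and sum_i a_i = c. *)
Fixpoint hull s c x : Prop :=
  if s is v :: s' then exists2 a, 0 <= a & hull s' (c - a) (x - a *: v)
  else c = 0 /\ x = 0.

Lemma hull0 s : hull s 0 0.
Proof.
elim: s => //= v s IH; exists 0 => //.
by rewrite scale0r !subr0.
Qed.

Lemma hull_ge0 s c x : hull s c x -> 0 <= c.
Proof.
elim: s c x => [c x [->]//|v s IH c x /= [a a0 /IH]]; lra.
Qed.

Lemma hullD s c d x y : hull s c x -> hull s d y -> hull s (c + d) (x + y).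
Proof.
elim: s c d x y => [c d x y [-> ->] [-> ->]|v s IH c d x y /= [a a0 H] [b b0 G]].
  by rewrite /= !addr0.
exists (a + b); first lra.
rewrite scalerDl !opprD (addrACA c) (addrACA x); exact: IH.
Qed.

Lemma hullZ s c x (k : R) : 0 <= k -> hull s c x -> hull s (k * c) (k *: x).
Proof.
move=> k0; elim: s c x => [c x [-> ->]|v s IH c x /= [a a0 H]].
  by rewrite mulr0 scaler0.
exists (k * a); first exact: mulr_ge0.
by rewrite -mulrBr -scalerA -scalerBr; exact: IH.
Qed.

Lemma hull_mem s v : v \in s -> hull s 1 v.
Proof.
elim: s => // u s IH; rewrite inE => /orP[/eqP ->|/IH H] /=.
  by exists 1; rewrite // scale1r !subrr; exact: hull0.
by exists 0; rewrite // scale0r !subr0.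
Qed.

Lemma hull_memZ s v a : v \in s -> 0 <= a -> hull s a (a *: v).
Proof. by move=> /hull_mem vs a0; have := hullZ a0 vs; rewrite mulr1. Qed.

Lemma hull_trans s r c x :
  (forall v, v \in s -> hull r 1 v) -> hull s c x -> hull r c x.
Proof.
elim: s c x => [c x _ [-> ->]|v s IH c x sr /= [a a0 H]]; first exact: hull0.
rewrite -(subrK a c) -(subrK (a *: v) x); apply: hullD.
  by apply: IH H => u us; apply: sr; rewrite inE us orbT.
by rewrite -[a in X in hull r X]mulr1; apply: hullZ => //; apply: sr; rewrite mem_head.
Qed.

Lemma hull_sub s r c x : {subset s <= r} -> hull s c x -> hull r c x.
Proof. by move=> sr; apply: hull_trans => v /sr; exact: hull_mem. Qed.

Lemma hull_eq s r c x : s =i r -> hull s c x <-> hull r c x.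
Proof. by move=> sr; split; apply: hull_sub => v; rewrite sr. Qed.

Lemma hull_sum (I : Type) (j : seq I) (P : pred I) s (a : I -> R) (w : I -> V) :
  (forall i, P i -> hull s (a i) (w i)) ->
  hull s (\sum_(i <- j | P i) a i) (\sum_(i <- j | P i) w i).
Proof.
move=> H; elim: j => [|i j IH]; first by rewrite !big_nil; exact: hull0.
by rewrite !big_cons; case: ifP => // Pi; apply: hullD => //; exact: H.
Qed.

Lemma conv_hullE s : conv_hull [set` s] = hull s 1.
Proof.
apply/seteqP; split => x.
  move=> [k [v [a [vs a0 a1 ->]]]]; rewrite -a1; apply: hull_sum => i _.
  exact: hull_memZ (vs i) (a0 i).
suff H c : hull s c x -> exists k (w : 'I_k -> V) (a : 'I_k -> R),
    [/\ forall i, w i \in s, forall i, 0 <= a i, \sum_i a i = c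
      & x = \sum_i a i *: w i] by exact: H.
elim: s c x => [c x [-> ->]|v s IH c x /= [a a0 /IH]].
  exists 0%N, (fun=> 0), (fun=> 0); split => //; rewrite ?big_ord0 //.
  by case.
move=> [k [w [b [ws b0 b1 xE]]]].
exists k.+1, (fun i => if unlift ord0 i is Some j then w j else v),
  (fun i => if unlift ord0 i is Some j then b j else a); split.
- move=> i; case: unliftP => [j _|_]; rewrite /= inE ?eqxx//.
  by apply/orP; right; exact: ws.
- by move=> i; case: unliftP.
- rewrite big_ord_recl unlift_none.
  by under eq_bigr do rewrite liftK; rewrite b1 addrC subrK.
- rewrite big_ord_recl unlift_none.
  by under eq_bigr do rewrite liftK; rewrite -xE addrC subrK.
Qed.

Lemma polytopeE (P : set V) : polytope P <-> exists s, P = hull s 1.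
Proof. by split=> -[s ->]; exists s; rewrite conv_hullE. Qed.


Definition lin (l : 'rV[R]_n) x : R := (l *m x) 0 0.

Lemma linD l x y : lin l (x + y) = lin l x + lin l y.
Proof. by rewrite /lin mulmxDr mxE. Qed.

Lemma linZ l a x : lin l (a *: x) = a * lin l x.
Proof. by rewrite /lin -scalemxAr mxE. Qed.

Lemma linB l x y : lin l (x - y) = lin l x - lin l y.
Proof. by rewrite linD -scaleN1r linZ mulN1r. Qed.

Lemma lin0 l : lin l 0 = 0.
Proof. by rewrite /lin mulmx0 mxE. Qed.

Lemma linDl l k x : lin (l + k) x = lin l x + lin k x.
Proof. by rewrite /lin mulmxDl mxE. Qed.

Lemma linZl l a x : lin (a *: l) x = a * lin l x.
Proof. by rewrite /lin -scalemxAl mxE. Qed.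

Lemma linNl l x : lin (- l) x = - lin l x.
Proof. by rewrite -scaleN1r linZl mulN1r. Qed.

Lemma linBl l k x : lin (l - k) x = lin l x - lin k x.
Proof. by rewrite linDl linNl. Qed.

Lemma lin0l x : lin 0 x = 0.
Proof. by rewrite /lin mul0mx mxE. Qed.

Lemma lin_delta i x : lin (delta_mx 0 i) x = x i 0.
Proof. by rewrite /lin -rowE mxE. Qed.

Lemma linE l x : lin l x = \sum_i l 0 i * x i 0.
Proof. by rewrite /lin mxE. Qed.

(** A constraint with [q p > 0] bounds [a] below by [P p / q p], one with [q p < 0] bounds it above,
    and [0 <= a] is one more lower bound. A solution exists iff no lower bound exceeds an upper one
    and the constraints free of [a] hold. *)
Lemma fourier_motzkin (T : eqType) (hs : seq T) (P q : T -> R) :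
  (exists2 a, 0 <= a & {in hs, forall p, P p <= a * q p}) <->
  {in hs, forall p, q p <= 0 -> P p <= 0} /\
  {in hs &, forall p p', 0 < q p -> q p' < 0 -> q p * P p' <= q p' * P p}.
Proof.
split=> [[a a0 H]|[H1 H2]].
  split=> [p hp qp|p p' hp hp' qp qp'].
    by apply: le_trans (H p hp) _; rewrite mulr_ge0_le0.
  have := H p hp; have := H p' hp' => Hp' Hp.
  have := ler_wpM2l (ltW qp) Hp'; have := ler_wnM2l (ltW qp') Hp.
  rewrite mulrCA (mulrCA (q p)) (mulrC (q p')); exact: (fun A B => le_trans B A).
(* The largest lower bound, the 0 of [0 <= a] included. *)
pose a := \big[Num.max/0]_(p <- hs | (p \in hs) && (0 < q p)) (P p / q p).
have a0 : 0 <= a by exact: bigmax_ge_id.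
exists a => // p hp; case: (ltgtP (q p) 0) => qp.
- rewrite -ler_ndivlMr//; apply: bigmax_le.
    by rewrite nmulr_lge0 ?invr_lt0//; apply: H1 => //; exact: ltW.
  move=> p' /andP[hp' qp'].
  rewrite ler_ndivlMr// mulrAC ler_pdivlMr// mulrC [leRHS]mulrC.
  exact: H2.
- rewrite -ler_pdivrMr//.
  apply: (@Order.TotalTheory.le_bigmax_seq _ _ _ hs 0 p _ (fun p => P p / q p)) => //.
  by rewrite hp.
- by rewrite qp mulr0; apply: H1 => //; rewrite qp.
Qed.

(* Minkowski-Weyl by eliminating one coefficient at a time; [hull s] is treated as
   a cone in the variable (c, x), so that no boundedness argument is needed. *)
Lemma hull_halfspaces s : exists hs : seq ('rV[R]_n * R), forall c x,
  hull s c x <-> {in hs, forall p, lin p.1 x <= p.2 * c}.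
Proof.
elim: s => [|v s [hs IH]].
  pose E := [seq (delta_mx 0 i : 'rV[R]_n, 0 : R) | i <- enum 'I_n].
  pose F := [seq (- delta_mx 0 i : 'rV[R]_n, 0 : R) | i <- enum 'I_n].
  exists ((0, 1) :: (0, -1) :: E ++ F) => c x; split.
    by move=> [-> ->] p _; rewrite lin0 mulr0.
  move=> H; split.
    have := H (0, 1); have := H (0, -1).
    rewrite !inE !eqxx ?orbT /= lin0l => /(_ isT) A /(_ isT) B; lra.
  apply/colP => i; rewrite mxE.
  have iE : (delta_mx 0 i, 0) \in E by apply/mapP; exists i; rewrite ?mem_enum.
  have iF : (- delta_mx 0 i, 0) \in F by apply/mapP; exists i; rewrite ?mem_enum.
  have := H (delta_mx 0 i, 0); have := H (- delta_mx 0 i, 0).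
  rewrite !inE !mem_cat iE iF !orbT /= linNl lin_delta => /(_ isT) A /(_ isT) B; lra.
pose q (p : 'rV[R]_n * R) := lin p.1 v - p.2.
(* For [q p' < 0 < q p], the positive combination of the two constraints in which the coefficient of
   [v] cancels. *)
pose comb (p p' : 'rV[R]_n * R) :=
  (q p *: p'.1 - q p' *: p.1, q p * p'.2 - q p' * p.2).
exists ([seq p <- hs | q p <= 0] ++
  [seq comb p p' | p <- [seq p <- hs | 0 < q p], p' <- [seq p <- hs | q p < 0]]).
move=> c x; rewrite [hull _ _ _]/=.
have -> : (exists2 a, 0 <= a & hull s (c - a) (x - a *: v)) <->
    exists2 a, 0 <= a & {in hs, forall p, lin p.1 x - p.2 * c <= a * q p}.
  split=> -[a a0 H]; exists a => //.
    move=> p hp; have := (IH _ _).1 H p hp.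
    by rewrite linB linZ /q; lra.
  apply/IH => p hp; have := H p hp.
  by rewrite linB linZ /q; lra.
rewrite fourier_motzkin; split=> [[H1 H2] p|H].
  rewrite mem_cat => /orP[|].
    by rewrite mem_filter => /andP[qp hp]; have := H1 p hp qp; lra.
  case/allpairsP => -[p1 p2] /= []; rewrite !mem_filter => /andP[q1 h1] /andP[q2 h2] ->.
  have := H2 _ _ h1 h2 q1 q2; rewrite /= linBl !linZl; lra.
split=> [p hp qp|p p' hp hp' qp qp'].
  have := H p; rewrite mem_cat mem_filter qp hp => /(_ isT); lra.
have := H (comb p p'); rewrite mem_cat.
rewrite [X in _ || X](_ : _ = true); last first.
  by apply/allpairsP; exists (p, p'); rewrite !mem_filter qp qp' hp hp'.
rewrite orbT /= linBl !linZl => /(_ isT); lra.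
Qed.


Lemma hull_lin_le s l d c x :
  {in s, forall v, lin l v <= d} -> hull s c x -> lin l x <= d * c.
Proof.
elim: s c x => [c x _ [-> ->]|v s IH c x sl /= [a a0 H]].
  by rewrite lin0 mulr0.
have sl' : {in s, forall u, lin l u <= d} by move=> u us; apply: sl; rewrite inE us orbT.
have := IH _ _ sl' H; rewrite linB linZ.
have := ler_wpM2l a0 (sl v (mem_head _ _)); lra.
Qed.

Lemma hull_lin_ge s l d c x :
  {in s, forall v, d <= lin l v} -> hull s c x -> d * c <= lin l x.
Proof.
move=> sl H; have := @hull_lin_le s (- l) (- d) c x.
rewrite linNl mulNr lerN2; apply => // v vs.
by rewrite linNl lerN2; exact: sl.
Qed.

(** * Cutting a finitely generated hull by a half-space *)

Section crossing.
Variables (l : 'rV[R]_n) (d : R).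
Local Notation h u := (lin l u - d).

(** For [h u < 0 < h v], the point where the segment from [v] to [u] meets the hyperplane
    [lin l = d]. *)
Definition crossing v u : V := (h v - h u)^-1 *: (h v *: u - h u *: v).

Lemma lin_crossing v u : 0 < h v -> h u < 0 -> lin l (crossing v u) = d.
Proof.
move=> hv hu; rewrite /crossing linZ linB !linZ.
have ne : h v - h u != 0 by rewrite gt_eqF//; lra.
apply: (mulfI ne); rewrite mulrA divff// mul1r; ring.
Qed.

Lemma crossing_hull v u : 0 < h v -> h u < 0 -> hull [:: v; u] 1 (crossing v u).
Proof.
move=> hv hu.
have ne : h v - h u != 0 by rewrite gt_eqF//; lra.
have ge : 0 <= (h v - h u)^-1 by rewrite invr_ge0; lra.
have -> : 1 = (h v - h u)^-1 * (h v - h u) by rewrite mulVf.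
apply: hullZ => //; rewrite -scaleNr; apply: hullD; apply: hull_memZ; rewrite ?inE ?eqxx ?orbT//; lra.
Qed.

(* Walking through s, the generator v on the wrong side of the hyperplane is traded
   against the generators on the good side, each trade producing a crossing point. *)
Lemma hull_absorb v s c x a : 0 < h v -> 0 <= a -> hull s c x ->
  lin l x - d * c + a * h v <= 0 ->
  hull (s ++ [seq crossing v u | u <- s & h u < 0]) (c + a) (x + a *: v).
Proof.
move=> hv; elim: s c x a => [c x a a0 [-> ->]|u s IH c x a a0 [b b0 H]].
  rewrite lin0 mulr0 subr0 add0r pmulr_lle0// => a1.
  have -> : a = 0 by lra.
  by rewrite scale0r !addr0.
move=> hx; set r := (X in hull X).
have sr c' x' : hull (s ++ [seq crossing v u | u <- s & h u < 0]) c' x' -> hull r c' x'.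
  apply: hull_sub => w; rewrite /r mem_cat => /orP[ws|ws] /=; case: ifP => _ /=.
  - by rewrite inE mem_cat ws orbT.
  - by rewrite inE mem_cat ws orbT.
  - by rewrite inE mem_cat inE ws !orbT.
  - by rewrite inE mem_cat ws !orbT.
have ur b' : 0 <= b' -> hull r b' (b' *: u).
  by apply: hull_memZ; rewrite /r /= mem_head.
have [hu|hu] := leP 0 (h u).
  have := IH (c - b) (x - b *: u) a a0 H.
  rewrite linB linZ => /(_ _)/sr K.
  have -> : c + a = c - b + a + b by ring.
  have -> : x + a *: v = x - b *: u + a *: v + b *: u by rewrite addrAC subrK.
  apply: hullD; last exact: ur.
  by apply: K; have := mulr_ge0 b0 hu; lra.
have wr g : 0 <= g -> hull r g (g *: crossing v u).
  apply: hull_memZ; rewrite /r mem_cat; apply/orP; right.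
  by apply: (map_f (crossing v)); rewrite mem_filter hu mem_head.
(* A weight [t * (h v - h u)] of the crossing point consumes [t * h v] of [u] and [- t * h u] of
   [v]. *)
have gE t : (t * (h v - h u)) *: crossing v u = (t * h v) *: u - (t * h u) *: v.
  rewrite /crossing scalerA mulfK ?gt_eqF//; last lra.
  by rewrite scalerBr !scalerA.
have [hab|hab] := leP (a * h v) (- (b * h u)).
  (* The weight of [u] suffices to use up all of [v]; the rest of [u] is returned. *)
  pose t := a / (- h u).
  have t0 : 0 <= t by rewrite divr_ge0//; lra.
  have th : t * h u = - a by rewrite /t invrN mulrN mulNr divfK// lt_eqF.
  have tb : t * h v <= b by rewrite /t mulrAC ler_pdivrMr; lra.
  have -> : c + a = (c - b) + (t * (h v - h u)) + (b - t * h v) by rewrite mulrBr th; ring.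
  have -> : x + a *: v = (x - b *: u) + (t * (h v - h u)) *: crossing v u + (b - t * h v) *: u.
    by rewrite gE th; apply/colP => i; rewrite !mxE; ring.
  apply: hullD; last by apply: ur; lra.
  apply: hullD; last by apply: wr; apply: mulr_ge0 => //; lra.
  by apply: sr; apply: hull_sub H => w ws; rewrite mem_cat ws.
(* All of [u] is spent, and the remaining weight [a + t * h u] of [v] goes to the induction
   hypothesis. *)
pose t := b / h v.
have t0 : 0 <= t by rewrite divr_ge0//; lra.
have th : t * h v = b by rewrite /t divfK// gt_eqF.
have ta : 0 <= a + t * h u.
  by rewrite -(pmulr_lge0 _ hv) mulrDl mulrAC th; lra.
have -> : c + a = (c - b + (a + t * h u)) + (t * (h v - h u)) by rewrite -th; ring.
have -> : x + a *: v = (x - b *: u + (a + t * h u) *: v) + (t * (h v - h u)) *: crossing v u.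
  by rewrite gE th; apply/colP => i; rewrite !mxE; ring.
apply: hullD; last by apply: wr; apply: mulr_ge0 => //; lra.
apply: sr; apply: IH => //.
rewrite linB linZ; have : t * h u * h v = b * h u by rewrite mulrAC th.
lra.
Qed.

(** The generators in [r] beyond the hyperplane are absorbed one at a time; the crossing points of
    each with [s] lie on the hyperplane and join the good side. *)
Lemma hull_halfspace_pos r s : {in r, forall v, 0 < h v} -> {in s, forall v, h v <= 0} ->
  exists s', forall c x, (hull (r ++ s) c x /\ lin l x <= d * c) <-> hull s' c x.
Proof.
elim: r s => [|v r IH] s hr hs.
  exists s => c x /=; split=> [[]//|H]; split => //.
  by apply: hull_lin_le H => u /hs; lra.
have hv : 0 < h v by apply: hr; rewrite mem_head.
have hr' : {in r, forall v, 0 < h v} by move=> u ur; apply: hr; rewrite inE ur orbT.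
pose cs := [seq crossing v u | u <- s & h u < 0].
have hcs : {in cs, forall w, lin l w = d}.
  by move=> w /mapP[u]; rewrite mem_filter => /andP[hu us] ->; exact: lin_crossing.
have [|s' Hs'] := IH (s ++ cs) hr'.
  by move=> w; rewrite mem_cat => /orP[/hs//|/hcs ->]; rewrite subrr.
exists s' => c x; rewrite -Hs'; split=> -[H hx]; split => //.
  case: H => a a0 H.
  have := hull_absorb hv a0 H; rewrite !subrK linB linZ => /(_ _).
  rewrite catA filter_cat (_ : [seq u <- r | h u < 0] = [::]).
    by apply; lra.
  apply/eqP; rewrite -(negbK (_ == _)) -has_filter; apply/hasPn => u /hr'; lra.
apply: hull_trans H => w; rewrite !mem_cat => /or3P[wr|ws|/mapP[u]].
- by apply: hull_mem; rewrite inE mem_cat wr orbT.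
- by apply: hull_mem; rewrite inE mem_cat ws !orbT.
rewrite mem_filter => /andP[hu us] ->.
apply: hull_sub (crossing_hull hv hu) => z; rewrite !inE mem_cat => /orP[->//|/eqP ->].
by rewrite us !orbT.
Qed.

Lemma hull_halfspace s :
  exists s', forall c x, (hull s c x /\ lin l x <= d * c) <-> hull s' c x.
Proof.
have [||s' H] := @hull_halfspace_pos [seq u <- s | 0 < h u] [seq u <- s | ~~ (0 < h u)].
- by move=> v; rewrite mem_filter => /andP[].
- by move=> v; rewrite mem_filter => /andP[]; lra.
exists s' => c x; rewrite -H.
suff E : hull s c x <-> hull ([seq u <- s | 0 < h u] ++ [seq u <- s | ~~ (0 < h u)]) c x.
  by split=> -[/E].
by apply: hull_eq => v; rewrite mem_cat !mem_filter -andb_orl orbN.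
Qed.

End crossing.

Definition halfspace (p : 'rV[R]_n * R) : set V := [set x | lin p.1 x <= p.2].

Definition polyhedron (hs : seq ('rV[R]_n * R)) : set V :=
  [set x | {in hs, forall p, halfspace p x}].

Lemma polyhedron_cons p hs :
  polyhedron (p :: hs) = halfspace p `&` polyhedron hs.
Proof.
apply/seteqP; split=> x.
  by move=> H; split=> [|q qs]; apply: H; rewrite inE ?eqxx// qs orbT.
by move=> [H1 H2] q; rewrite inE => /orP[/eqP -> //|/H2].
Qed.

Lemma polytope_halfspace (P : set V) p : polytope P -> polytope (P `&` halfspace p).
Proof.
move=> /polytopeE[s ->]; have [s' H] := hull_halfspace p.1 p.2 s.
apply/polytopeE; exists s'; apply/seteqP; split=> x.
  by move=> [H1 H2]; apply/H; rewrite mulr1.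
by move=> /H; rewrite mulr1.
Qed.

Lemma polytope0_halfspace (P : set V) p : 0 <= p.2 ->
  polytope0 P -> polytope0 (P `&` halfspace p).
Proof.
move=> p0 [pP P0]; split; first exact: polytope_halfspace.
by split => //; rewrite /halfspace /= lin0.
Qed.

Lemma polytope0_polyhedron (P : set V) hs : {in hs, forall p, 0 <= p.2} ->
  polytope0 P -> polytope0 (P `&` polyhedron hs).
Proof.
elim: hs P => [|p hs IH] P h0 pP.
  by rewrite (_ : polyhedron _ = setT) ?setIT//; apply/seteqP; split.
rewrite polyhedron_cons setIA; apply: IH.
  by move=> q qs; apply: h0; rewrite inE qs orbT.
by apply: polytope0_halfspace => //; apply: h0; rewrite mem_head.
Qed.

Lemma polytopeP (P : set V) : polytope P -> exists hs, P = polyhedron hs.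
Proof.
move=> /polytopeE[s ->]; have [hs H] := hull_halfspaces s.
exists hs; apply/seteqP; split=> x.
  by move=> /H K p /K; rewrite mulr1.
by move=> K; apply/H => p /K; rewrite mulr1.
Qed.

Lemma polytope0P (P : set V) : polytope0 P ->
  exists2 hs, {in hs, forall p, 0 <= p.2} & P = polyhedron hs.
Proof.
move=> [/polytopeP[hs ->] P0]; exists hs => // p ps.
by have := P0 p ps; rewrite /halfspace /= lin0.
Qed.


End hulls.

(** * Valuations vanishing on simplices with vertex 0 *)

Section simplices.
Context (R : realType) (n : nat).
Local Notation V := 'cV[R]_n.
Implicit Types (s r : seq V) (x y u v w : V) (a b c d e t : R).

(* The convex hull of 0 and s. *)
Definition simplex s : set V := hull (0 :: s) 1.

Lemma hull_cons0 s c x : hull (0 :: s) c x <-> exists2 c', c' <= c & hull s c' x.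
Proof.
split=> [[a a0]|[c' cc' H]]; first by rewrite scaler0 subr0 => H; exists (c - a) => //; lra.
by exists (c - c'); rewrite ?scaler0 ?subr0 ?subr_ge0 // opprB addrC subrK.
Qed.

Lemma simplexP s x : simplex s x <-> exists2 c, c <= 1 & hull s c x.
Proof. exact: hull_cons0. Qed.

Lemma polytope0_simplex s : polytope0 (simplex s).
Proof.
split; first by apply/polytopeE; exists (0 :: s).
by apply/simplexP; exists 0; [exact: ler01|exact: hull0].
Qed.

Lemma simplex_nil : simplex [::] = [set 0].
Proof.
apply/seteqP; split=> x; first by case/simplexP => c' _ [].
by move=> ->; case: (polytope0_simplex [::]).
Qed.

Lemma simplex_eq s r : s =i r -> simplex s = simplex r.
Proof.
move=> sr; apply/seteqP; split=> x; apply: hull_sub => v; by rewrite !inE sr.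
Qed.

Lemma hull_span s c x : hull s c x -> x \in << s >>%VS.
Proof.
elim: s c x => [c x [_ ->]|v s IH c x /= [a a0 /IH H]]; first exact: mem0v.
rewrite -(subrK (a *: v) x) memvD//.
  by apply: subvP H; rewrite span_cons addvSr.
by rewrite memvZ// memv_span// mem_head.
Qed.

Lemma free_swap u v r : free [:: u, v & r] = free [:: v, u & r].
Proof. by apply: perm_free; by apply/permPl; exact: (perm_catCA [:: u] [:: v] r). Qed.

Lemma free_replace v w r a : a != 0 -> w - a *: v \in << r >>%VS ->
  free (v :: r) -> free (w :: r).
Proof.
move=> a0 wv; rewrite !free_cons => /andP[vr ->]; rewrite andbT.
apply: contra vr => wr.
have : a *: v \in << r >>%VS by rewrite -[a *: v](subKr w) memvB.
by rewrite rpredZeq (negbTE a0).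
Qed.

(** * Cutting a simplex at a point [w] of the edge from [u] to [v] *)

Section cut.
Variables (u v : V) (r : seq V) (t : R).
Hypotheses (t0 : 0 < t) (t1 : t < 1) (ufree : free [:: u, v & r]).
Let w := (1 - t) *: u + t *: v.

Lemma free_cut_left : free [:: u, w & r].
Proof.
rewrite free_swap; apply: (@free_replace v _ _ t); first by rewrite gt_eqF.
  by rewrite addrK memvZ// memv_span// mem_head.
by rewrite free_swap.
Qed.

Lemma free_cut_right : free [:: w, v & r].
Proof.
apply: (@free_replace u _ _ (1 - t)) => //; first by rewrite gt_eqF// subr_gt0.
by rewrite addrC addKr memvZ// memv_span// mem_head.
Qed.

Lemma free_cut_mid : free (w :: r).
Proof. by have := free_cut_left; rewrite free_cons => /andP[]. Qed.

Lemma simplex_cutU : simplex [:: u, v & r] = simplex [:: u, w & r] `|` simplex [:: w, v & r].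
Proof.
have t1' : 0 < 1 - t by rewrite subr_gt0.
apply/seteqP; split=> x; last first.
  have wE : hull [:: 0, u, v & r] 1 w.
    have -> : 1 = (1 - t) + t by ring.
    by apply: hullD; apply: hull_memZ; rewrite ?inE ?eqxx ?orbT//; exact: ltW.
  move=> [] H; apply: hull_trans H => z; rewrite !inE.
    by move=> /or4P[/eqP->|/eqP->|/eqP->//|zr]; apply: hull_mem; rewrite !inE ?eqxx ?zr ?orbT.
  by move=> /or4P[/eqP->|/eqP->//|/eqP->|zr]; apply: hull_mem; rewrite !inE ?eqxx ?zr ?orbT.
move=> /simplexP[c c1 /= [a a0 [b b0 H]]].
(* The test tells on which side of [w] the part [a *: u + b *: v] lies: on the side of [u], [v] is
   rewritten through [w]; on the other side, [u] is. *)
have [ab|ab] := leP (b * (1 - t)) (a * t); [left|right]; apply/simplexP; exists c => //=.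
  exists (a - b * (1 - t) / t); first by rewrite subr_ge0 ler_pdivrMr.
  exists (b / t); first by apply: divr_ge0 => //; exact: ltW.
  have -> : c - (a - b * (1 - t) / t) - b / t = c - a - b by field; rewrite gt_eqF.
  rewrite (_ : _ - _ - _ = x - a *: u - b *: v)//.
  by apply/colP => i; rewrite /w !mxE; field; rewrite gt_eqF.
exists (a / (1 - t)); first by apply: divr_ge0 => //; exact: ltW.
exists (b - a * t / (1 - t)); first by rewrite subr_ge0 ler_pdivrMr// ltW.
have -> : c - a / (1 - t) - (b - a * t / (1 - t)) = c - a - b by field; rewrite gt_eqF.
rewrite (_ : _ - _ - _ = x - a *: u - b *: v)//.
by apply/colP => i; rewrite /w !mxE; field; rewrite gt_eqF.
Qed.

(** The two expansions of a common point differ by a relation between [u] and [v] modulo the span of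
    [r]. Freeness makes both coefficients vanish, and the signs then force the weight of [u] to be
    0. *)
Lemma simplex_cutI : simplex [:: u, w & r] `&` simplex [:: w, v & r] = simplex (w :: r).
Proof.
have t1' : 0 < 1 - t by rewrite subr_gt0.
apply/seteqP; split=> x; last first.
  move=> H; split; apply: hull_sub H => z; rewrite !inE => /or3P[] ->; by rewrite ?orbT.
move=> [/simplexP[c c1 /= [a a0 [g g0 H]]] /simplexP[c' c1' /= [g' g0' [b b0 H']]]].
apply/simplexP; exists c => //=; exists g => //.
suff a00 : a = 0 by move: H; rewrite a00 scale0r !subr0.
have rel : (a + (g - g') * (1 - t)) *: u + ((g - g') * t - b) *: v \in << r >>%VS.
  have := memvB (hull_span H') (hull_span H).
  rewrite (_ : _ - _ - _ = (a + (g - g') * (1 - t)) *: u + ((g - g') * t - b) *: v)//.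
  by apply/colP => i; rewrite /w !mxE; ring.
move: ufree; rewrite !free_cons => /andP[uvr /andP[vr _]].
have A0 : a + (g - g') * (1 - t) = 0.
  apply/eqP; apply: contraNT uvr => A0.
  have : (a + (g - g') * (1 - t)) *: u \in << v :: r >>%VS.
    rewrite -[X in X \in _](addrK (((g - g') * t - b) *: v)).
    rewrite memvB//; first by apply: subvP rel; rewrite span_cons addvSr.
    by rewrite memvZ// memv_span// mem_head.
  by rewrite rpredZeq (negbTE A0).
move: rel; rewrite A0 scale0r add0r rpredZeq => /orP[/eqP B0|]; last by rewrite (negbTE vr).
have gg : 0 <= g - g' by rewrite -(pmulr_lge0 _ t0); lra.
by have := mulr_ge0 gg (ltW t1'); lra.
Qed.

End cut.
End simplices.

(** * From simplices with vertex 0 to all polytopes containing 0 *)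

Section vanishing.
Context (R : realType) (n : nat).
Local Notation V := 'cV[R]_n.
Implicit Types (s r : seq V) (x y u v w : V) (l : 'rV[R]_n) (a b c d e t : R).

Lemma free_rescale s (f : V -> R) : (forall v, v \in s -> f v != 0) ->
  free s -> free [seq f v *: v | v <- s].
Proof.
move=> f0 sfree.
suff [] : free [seq f v *: v | v <- s] /\ (<< [seq f v *: v | v <- s] >> <= << s >>)%VS by [].
elim: s f0 sfree => [|v s IH] f0 //; rewrite /= !free_cons => /andP[vs sfree].
have [|F S] := IH _ sfree; first by move=> u us; apply: f0; rewrite inE us orbT.
split.
  rewrite F andbT; apply: contra vs => /(subvP S).
  by rewrite rpredZeq (negbTE (f0 _ (mem_head _ _))).
rewrite !span_cons; apply: addvS => //.
by rewrite -memvE memvZ// memv_line.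
Qed.

(** Moving all generators along their rays onto [lin l = d] turns the level of [x] into
    [lin l x / d], so that level at most 1 becomes the half-space condition. *)
Lemma hull_rescale s l d c x : {in s, forall v, 0 < lin l v} -> 0 < d ->
  hull s c x -> hull [seq (d / lin l v) *: v | v <- s] (lin l x / d) x.
Proof.
move=> ls d0; elim: s c x ls => [c x _ [_ ->]|v s IH c x ls /= [a a0 H]].
  by rewrite lin0 mul0r.
have lv := ls v (mem_head _ _).
exists (a * lin l v / d); first by rewrite !mulr_ge0// ?invr_ge0 ltW.
have ls' : {in s, forall v, 0 < lin l v}.
  by move=> u us; apply: ls; rewrite inE us orbT.
have := IH _ _ ls' H; rewrite linB linZ mulrBl scalerA.
by rewrite (_ : a * lin l v / d * (d / lin l v) = a)//; field; rewrite !gt_eqF.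
Qed.

(** Nonnegative terms with sum at most 0 all vanish, so only the generators on [lin l = 0] carry
    weight. *)
Lemma hull_filter_eq0 s l c x : {in s, forall v, 0 <= lin l v} -> lin l x <= 0 ->
  hull s c x -> hull [seq v <- s | lin l v == 0] c x.
Proof.
move=> ls; elim: s c x ls => // v s IH c x ls lx /= [a a0 H].
have lv := ls v (mem_head _ _).
have ls' : {in s, forall v, 0 <= lin l v}.
  by move=> u us; apply: ls; rewrite inE us orbT.
have ly : 0 <= lin l (x - a *: v) by have := hull_lin_ge ls' H; rewrite mul0r.
have alv := mulr_ge0 a0 lv; move: (ly); rewrite linB linZ => ly'.
have {}H := IH _ _ ls' _ H.
case: eqP => lv0 /=.
  by exists a => //; apply: H; rewrite linB linZ; lra.
have a00 : a = 0.
  apply/eqP; have : a * lin l v == 0 by apply/eqP; lra.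
  by rewrite mulf_eq0 => /orP[//|/eqP].
by move: H; rewrite a00 scale0r !subr0; apply.
Qed.

Lemma seq_two_perm (T : eqType) (s : seq T) (p q : pred T) :
  has p s -> has q s -> (forall z, p z -> q z -> False) ->
  exists (u v : T) (r : seq T), [/\ p u, q v & perm_eq s [:: u, v & r]].
Proof.
move=> /hasP[u us pu] /hasP[v vs qv] pq.
exists u, v, (rem v (rem u s)); split => //.
apply: (perm_trans (perm_to_rem us)); rewrite perm_cons perm_to_rem//.
move: vs; rewrite (perm_mem (perm_to_rem us)) inE => /orP[/eqP vu|//].
by exfalso; apply: (pq u) => //; rewrite -vu.
Qed.

Section valuation_vanishing.
Variable Phi : set V -> R.
Hypotheses (Phi_val : valuation (@polytope0 R n) Phi)
  (Phi_simplex : forall s, free s -> Phi (simplex s) = 0).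

Lemma vanish_simplex_cut (K : set V) (hs : seq ('rV[R]_n * R)) u v r t :
  0 < t -> t < 1 -> free [:: u, v & r] -> {in hs, forall p, 0 <= p.2} ->
  K = polyhedron hs ->
  let w := (1 - t) *: u + t *: v in
  Phi (simplex [:: u, w & r] `&` K) = 0 -> Phi (simplex [:: w, v & r] `&` K) = 0 ->
  Phi (simplex (w :: r) `&` K) = 0 -> Phi (simplex [:: u, v & r] `&` K) = 0.
Proof.
move=> t0 t1 uv h0 -> w A B C.
have pS s : polytope0 (simplex s `&` polyhedron hs).
  by apply: polytope0_polyhedron => //; exact: polytope0_simplex.
have := Phi_val (pS [:: u, w & r]) (pS [:: w, v & r]).
rewrite -setIIl (simplex_cutI t0 t1 uv) -setIUl -(simplex_cutU u v r t0 t1).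
move=> /(_ (pS _) (pS _)); rewrite A B C; lra.
Qed.

Lemma vanish_simplex_polyhedron hs s : {in hs, forall p, 0 <= p.2} -> free s ->
  Phi (simplex s `&` polyhedron hs) = 0.
Proof.
elim: hs s => [|[l d] hs IH] s h0 sfree.
  by rewrite (_ : polyhedron _ = setT) ?setIT ?Phi_simplex//; apply/seteqP; split.
have d0 : 0 <= d by exact: (h0 _ (mem_head _ _)).
have h0' : {in hs, forall p, 0 <= p.2} by move=> q qs; apply: h0; rewrite inE qs orbT.
pose K := polyhedron ((l, d) :: hs); rewrite -/K.
(* Induction on the number of vertices off the cutting hyperplane: each cut of
   an edge crossing it moves a vertex onto it. *)
have [k sk] := ubnP (count (fun v => lin l v != d) s).
elim: k s sfree sk => // k IHk s sfree; rewrite ltnS => sk.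
have Kle r : {in 0 :: r, forall v, lin l v <= d} -> simplex r `&` K = simplex r `&` polyhedron hs.
  move=> H; rewrite /K polyhedron_cons setIA; congr (_ `&` _).
  by apply/setIidPl => x /(hull_lin_le H); rewrite mulr1.
have [/hasPn slt|sgt] := boolP (~~ has (fun v => d < lin l v) s).
  rewrite Kle; first exact: IH.
  by move=> v; rewrite inE => /orP[/eqP -> |/slt]; [rewrite lin0|rewrite leNgt].
have [/hasPn sge|slt] := boolP (~~ has (fun v => lin l v < d) s); last first.
  move: sgt slt; rewrite !negbK => sgt slt.
  have [|u [v [r [ud dv suv]]]] := seq_two_perm slt sgt; first by move=> z; lra.
  have sE : simplex s = simplex [:: u, v & r] by apply: simplex_eq; exact: perm_mem.
  have uvfree : free [:: u, v & r] by rewrite -(perm_free suv).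
  pose t := (d - lin l u) / (lin l v - lin l u).
  have vu : 0 < lin l v - lin l u by lra.
  have t0 : 0 < t by rewrite divr_gt0//; lra.
  have t1 : t < 1 by rewrite ltr_pdivrMr//; lra.
  pose w := (1 - t) *: u + t *: v.
  have lw : lin l w = d by rewrite linD !linZ /t; field; rewrite gt_eqF.
  move: sk; rewrite (permP suv)/= lt_eqF// gt_eqF//= !add1n => sk.
  rewrite sE; apply: (vanish_simplex_cut t0 t1 uvfree h0) => //; apply: IHk.
  - exact: free_cut_left.
  - by rewrite /= lw eqxx lt_eqF.
  - exact: free_cut_right.
  - by rewrite /= lw eqxx gt_eqF.
  - by apply: (free_cut_mid t0 uvfree).
  - by rewrite /= lw eqxx; exact: ltnW.
have {}sge : {in s, forall v, d <= lin l v} by move=> v /sge; rewrite -leNgt.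
(* All nonzero vertices are now on or beyond the hyperplane. For [d = 0] only the face on it
   survives; for [d > 0] each vertex is pulled back along its ray onto it. *)
have [d00|dneq] := eqVneq d 0.
  pose r := [seq v <- s | lin l v == 0].
  have rE : simplex s `&` K = simplex r `&` K.
    apply/seteqP; split=> x [sx Kx]; split => //.
      have lx : lin l x <= 0.
        have := Kx (l, d) (mem_head _ _); by rewrite /halfspace /= d00.
      move/simplexP: sx => [c c1 sx]; apply/simplexP; exists c => //.
      by apply: (hull_filter_eq0 _ lx) => // v /sge; rewrite d00.
    apply: hull_sub sx => v; rewrite !inE => /orP[->//|].
    by rewrite mem_filter => /andP[_ ->]; rewrite orbT.
  rewrite rE Kle; first by apply: IH => //; exact: filter_free.
  move=> v; rewrite inE => /orP[/eqP ->|]; first by rewrite lin0.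
  by rewrite mem_filter => /andP[/eqP -> _].
have {dneq}d0 : 0 < d by rewrite lt_def dneq.
have spos : {in s, forall v, 0 < lin l v} by move=> v /sge; lra.
pose r := [seq (d / lin l v) *: v | v <- s].
have rE : simplex s `&` K = simplex r `&` K.
  apply/seteqP; split=> x [sx Kx]; split => //.
    have lx : lin l x <= d := Kx (l, d) (mem_head _ _).
    move/simplexP: sx => [c c1 sx]; apply/simplexP; exists (lin l x / d).
      by rewrite ler_pdivrMr// mul1r.
    exact: hull_rescale sx.
  apply: hull_trans sx => v; rewrite inE => /orP[/eqP ->|/mapP[u us ->]].
    by apply: hull_mem; rewrite mem_head.
  apply/hull_cons0; exists (d / lin l u).
    by rewrite ler_pdivrMr ?spos// mul1r sge.
  by apply: hull_memZ => //; rewrite divr_ge0 ?ltW// spos.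
rewrite rE Kle.
  apply: IH => //; apply: (@free_rescale s (fun v => d / lin l v)) => // v vs.
  by rewrite mulf_neq0 ?invr_eq0 ?gt_eqF// spos.
move=> v; rewrite inE => /orP[/eqP ->|/mapP[u us ->]]; first by rewrite lin0 ltW.
by rewrite linZ divfK// gt_eqF// spos.
Qed.

(** [M] bounds the levels in [s] of the finitely many generators in [r]; it tells how far the
    simplex on [s] must be enlarged to contain [hull r 1]. *)
Lemma hull_level s r : (forall v, v \in r -> exists c, hull s c v) ->
  exists2 M, 0 < M & forall c x, hull r c x -> exists2 c', c' <= M * c & hull s c' x.
Proof.
elim: r => [_|v r IH H].
  by exists 1 => // c x [-> ->]; exists 0; rewrite ?mulr0//; exact: hull0.
have [|M M0 HM] := IH; first by move=> u ur; apply: H; rewrite inE ur orbT.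
have [e He] := H v (mem_head _ _).
exists (M + e); first by have := hull_ge0 He; lra.
move=> c x [a a0 rx]; have [c' c'le sx] := HM _ _ rx.
exists (c' + a * e).
  have := mulr_ge0 (ltW M0) a0; have := mulr_ge0 (hull_ge0 He) (hull_ge0 rx); lra.
by rewrite -(subrK (a *: v) x); apply: hullD => //; exact: hullZ.
Qed.

(** The simplex on a large multiple of [s] contains [P], so [P] is that simplex cut by the
    half-spaces of [P], whose bounds are nonnegative because 0 is in [P]. *)
Lemma vanish_cone (P : set V) s : polytope0 P -> free s ->
  (forall x, P x -> exists c, hull s c x) -> Phi P = 0.
Proof.
move=> pP sfree Ps.
have [hs h0 PE] := polytope0P pP.
have /polytopeE[r rE] := pP.1.
have [|M M0 HM] := @hull_level s r.
  by move=> v vr; apply: Ps; rewrite rE; exact: hull_mem.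
pose s' := [seq M *: v | v <- s].
have -> : P = simplex s' `&` polyhedron hs.
  rewrite -PE; apply/esym/setIidPr => x; rewrite rE => /HM[c]; rewrite mulr1 => cM sx.
  apply/simplexP; exists (c / M); first by rewrite ler_pdivrMr// mul1r.
  have Mx : hull s' c (M *: x).
    rewrite /s'; elim: (s) (c) (x) sx => [c' x' [-> ->]|v s1 IH c' x' [a a0 H]].
      by rewrite scaler0.
    by exists a => //=; rewrite scalerA mulrC -scalerA -scalerBr; exact: IH.
  have iM0 : 0 <= M^-1 by rewrite invr_ge0 ltW.
  by have := hullZ iM0 Mx; rewrite scalerA mulVf ?scale1r 1?mulrC// gt_eqF.
apply: vanish_simplex_polyhedron => //.
by apply: (@free_rescale s (fun=> M)) => // v _; rewrite gt_eqF.
Qed.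

(* The indices in js are the coordinates not yet cut by sign; the generators in s
   are the signed basis vectors of the coordinates already cut. *)
Lemma vanish_orthant (js : seq 'I_n) s (P : set V) : polytope0 P ->
  free (s ++ [seq delta_mx j 0 | j <- js]) ->
  (forall x, P x -> exists c, hull s c (x - \sum_(j <- js) x j 0 *: delta_mx j 0)) ->
  Phi P = 0.
Proof.
elim: js s P => [|j js IH] s P pP sfree H.
  apply: (@vanish_cone P s) => //; first by move: sfree; rewrite cats0.
  by move=> x /H; rewrite big_nil subr0.
pose pos : 'rV[R]_n * R := (- delta_mx 0 j, 0).
pose neg : 'rV[R]_n * R := (delta_mx 0 j, 0).
have pP1 : polytope0 (P `&` halfspace pos) by apply: polytope0_halfspace.
have pP2 : polytope0 (P `&` halfspace neg) by apply: polytope0_halfspace.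
have pP3 : polytope0 ((P `&` halfspace pos) `&` (P `&` halfspace neg)).
  rewrite (_ : _ `&` _ = (P `&` halfspace pos) `&` halfspace neg).
    exact: polytope0_halfspace.
  by apply/seteqP; split=> x; [move=> [[? ?] []]|move=> [[? ?] ?]].
have PE : P = (P `&` halfspace pos) `|` (P `&` halfspace neg).
  apply/seteqP; split=> [x Px|x [[]|[]]//].
  by have [xj|xj] := leP 0 (x j 0); [left|right]; split => //;
    rewrite /halfspace /= ?linNl lin_delta; lra.
have perm_j u r : perm_eq (s ++ u :: r) ((u :: s) ++ r).
  by apply/permPl; exact: (perm_catCA s [:: u] r).
have free_j : free ((delta_mx j 0 :: s) ++ [seq delta_mx j 0 | j <- js]).
  by rewrite -(perm_free (perm_j _ _)).
have := Phi_val pP1 pP2; rewrite -PE => /(_ pP3 pP).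
rewrite (IH (delta_mx j 0 :: s) _ pP1)//; last first.
  move=> x [/H[c Hc]]; rewrite /halfspace /= linNl lin_delta oppr_le0 => xj.
  exists (c + x j 0), (x j 0) => //; rewrite addrK.
  by move: Hc; rewrite big_cons opprD addrA [X in hull _ _ X -> _]addrAC.
rewrite (IH (- delta_mx j 0 :: s) _ pP2); last first.
- move=> x [/H[c Hc]]; rewrite /halfspace /= lin_delta => xj.
  exists (c - x j 0), (- x j 0); first by rewrite oppr_ge0.
  rewrite opprK subrK scalerN scaleNr opprK.
  by move: Hc; rewrite big_cons opprD addrA [X in hull _ _ X -> _]addrAC.
- move: free_j; rewrite !cat_cons !free_cons => /andP[A ->]; rewrite andbT.
  by rewrite memvN.
(* On the intersection the coordinate [j] is 0, so no generator is added. *)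
rewrite (IH s _ pP3); last first.
- move=> x [[/H[c Hc] xj1] [_ xj2]]; exists c.
  have xj : x j 0 = 0.
    by move: xj1 xj2; rewrite /halfspace /= linNl lin_delta; lra.
  by move: Hc; rewrite big_cons xj scale0r add0r.
- by move: free_j; rewrite cat_cons free_cons => /andP[].
by rewrite !addr0 => <-.
Qed.

Lemma free_delta_enum : free [seq delta_mx j 0 : V | j <- enum 'I_n].
Proof.
apply: (@basis_free _ _ fullv); rewrite basisEdim; apply/andP; split; last first.
  by rewrite size_map size_enum_ord dimvf /dim /= muln1.
apply/subvP => x _; rewrite (matrix_sum_delta x); apply: memv_suml => i _.
rewrite big_ord1 memvZ// memv_span//; apply/mapP; exists i; rewrite ?mem_enum//.
Qed.

Lemma valuation_vanish P : polytope0 P -> Phi P = 0.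
Proof.
move=> pP; apply: (@vanish_orthant (enum 'I_n) [::] P pP free_delta_enum).
move=> x _; exists 0 => /=; split => //.
rewrite {1}(matrix_sum_delta x); apply/eqP; rewrite subr_eq0; apply/eqP.
by rewrite big_enum/=; apply: eq_bigr => i _; rewrite big_ord1.
Qed.

End valuation_vanishing.
End vanishing.

(** * SL(n) invariance of Lebesgue measure *)

Section lebesgue_SL.
Context (R : realType).
Local Notation mR := (measurableTypeR R).
Local Notation lambda := (@lebesgue_measure R).

Lemma measurable_addr (c : R) : measurable_fun setT ((fun x => x + c) : mR -> mR).
Proof. exact: (@measurable_realfun.measurable_funD _ _ _ setT id (cst c)). Qed.

(** The translated measure agrees with [lambda] on half-open intervals, which determine it. *)
Lemma lebesgue_measure_addr (c : R) (X : set mR) : measurable X ->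
  lambda ((fun x => x + c) @^-1` X) = lambda X.
Proof.
move=> mX.
pose nu : {measure set mR -> \bar R} :=
  measure_function_pushforward__canonical__measure_function_Measure
    lambda (measurable_addr c).
suff : lambda X = nu X by move=> ->.
apply: lebesgue_measure_unique => // _ [[a b] _ <-] /=.
rewrite /nu /= /pushforward.
have -> : (fun x => x + c) @^-1` `]a, b] = `]a - c, b - c]%classic.
  by apply/seteqP; split=> x /=; rewrite !in_itv /=; lra.
rewrite !lebesgue_measure_itv /= !lte_fin ltrD2r.
by case: ifP => // _; rewrite -!EFinB; congr (_%:E); ring.
Qed.

Definition measure_preserving n (f : n.-tuple mR -> n.-tuple mR) :=
  measurable_fun setT f /\
  forall X, measurable X -> lebesgue_tuple (f @^-1` X) = lebesgue_tuple X.

Lemma measure_preserving_comp n (f g : n.-tuple mR -> n.-tuple mR) :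
  measure_preserving f -> measure_preserving g -> measure_preserving (f \o g).
Proof.
move=> [mf pf] [mg pg]; split; first exact: measurableT_comp.
move=> X mX; rewrite comp_preimage pg ?pf//.
by rewrite -[X in measurable X]setTI; exact: mf.
Qed.

(** Integration with the first coordinate outermost: over [x], the section of the preimage is the
    preimage under [g x] of the section of [X]. *)
Lemma measure_preserving_fiberl n (G : n.+1.-tuple mR -> n.+1.-tuple mR)
    (g : mR -> n.-tuple mR -> n.-tuple mR) :
  measurable_fun setT G -> (forall x t, G (tcons (x, t)) = tcons (x, g x t)) ->
  (forall x, measure_preserving (g x)) -> measure_preserving G.
Proof.
move=> mG GE pg; split=> // X mX; rewrite /= /pushforward /product_measure1.
apply: eq_integral => x _ /=.
have mY : measurable (@tcons R n @^-1` X).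
  by rewrite -[X in measurable X]setTI; exact: measurable_tcons.
rewrite -[RHS](pg x).2; last exact: measurable_xsection.
by congr (lebesgue_tuple _); apply/seteqP; split=> t; rewrite /xsection /= !inE /= GE.
Qed.

(** Integration with the first coordinate innermost: the fibre over [t] is merely translated by
    [c t]. *)
Lemma measure_preserving_fiberr n (G : n.+1.-tuple mR -> n.+1.-tuple mR)
    (c : n.-tuple mR -> R) :
  measurable_fun setT G -> (forall x t, G (tcons (x, t)) = tcons (x + c t, t)) ->
  measure_preserving G.
Proof.
move=> mG GE; split=> // X mX; rewrite /= /pushforward.
have [mu ->] := lebesgue_tuple_measure R n.
have mt Y : measurable Y -> measurable (@tcons R n @^-1` Y).
  by move=> mY; rewrite -[X in measurable X]setTI; exact: measurable_tcons.
have mZ : measurable (@tcons R n @^-1` (G @^-1` X)).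
  by apply: mt; rewrite -[X in measurable X]setTI; exact: mG.
(* A product measure is determined by rectangles, which allows the order of integration to be
   exchanged. *)
have E A B : measurable A -> measurable B -> ((lambda \x^ mu) (A `*` B) = lambda A * mu B)%E.
  by move=> mA mB; rewrite product_measure2E.
rewrite !(product_measure_unique E) ?/product_measure2; [|exact: mt|by []].
apply: eq_integral => t _ /=.
rewrite -[RHS](lebesgue_measure_addr (c t)); last by apply: measurable_ysection; exact: mt.
by congr (lambda _); apply/seteqP; split=> x; rewrite /ysection /= !inE /= GE.
Qed.

Definition tcol n (t : n.-tuple mR) : 'cV[R]_n := \col_(i < n) tnth t i.

Definition colt n (x : 'cV[R]_n) : n.-tuple mR := [tuple x i 0 | i < n].

Lemma tcolK n : cancel (@tcol n) (@colt n).
Proof. by move=> t; apply: eq_from_tnth => i; rewrite tnth_mktuple mxE. Qed.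

Lemma coltK n : cancel (@colt n) (@tcol n).
Proof. by move=> x; apply/colP => i; rewrite mxE tnth_mktuple. Qed.

Lemma tcol_tcons n (p : mR * n.-tuple mR) :
  tcol (tcons p) = col_mx (p.1 : R)%:M (tcol p.2) :> 'cV[R]_(1 + n).
Proof.
apply/colP => i; rewrite [LHS]mxE; case: (unliftP ord0 i) => [j ->|->].
  rewrite tnthS (_ : lift ord0 j = rshift 1 j); last exact/val_inj.
  by rewrite col_mxEd mxE.
have -> : @ord0 n = lshift n (@ord0 0) by exact/val_inj.
by rewrite col_mxEu mxE eqxx mulr1n.
Qed.

(** Affine rather than linear: a lower block matrix acts on the fibre over [x] by [D] followed by a
    translation that depends on [x]. *)
Definition act n (A : 'M[R]_n) (v : 'cV[R]_n) (t : n.-tuple mR) : n.-tuple mR :=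
  colt (A *m tcol t + v).

Lemma measurable_act n (A : 'M[R]_n) v : measurable_fun setT (act A v).
Proof.
apply/measurable_fun_tnthP => i.
rewrite (_ : _ \o _ = (fun t => \sum_j A i j * (tnth t j : R)) \+ cst (v i 0)).
  apply: measurable_realfun.measurable_funD => //; apply: measurable_sum => j.
  apply: measurable_realfun.measurable_funM => //; exact: measurable_tnth.
apply/funext => t; rewrite /= tnth_mktuple !mxE; congr (_ + _).
by apply: eq_bigr => j _; rewrite mxE.
Qed.

Lemma act_comp n (A B : 'M[R]_n) v w : act A v \o act B w = act (A *m B) (A *m w + v).
Proof. by apply/funext => t; rewrite /act /= coltK mulmxDr mulmxA addrA. Qed.

Lemma act_tcons n (a : R) (b : 'rV[R]_n) c (D : 'M[R]_n) (e : R) v x t :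
  act (block_mx a%:M b c D : 'M[R]_(1 + n)) (col_mx e%:M v) (tcons (x, t)) =
  tcons (a * x + lin b (tcol t) + e, colt ((x : R) *: c + D *m tcol t + v)).
Proof.
apply: (can_inj (@tcolK n.+1)); rewrite /act coltK tcol_tcons coltK /= tcol_tcons.
rewrite mul_block_col add_col_mx -scalar_mxM mul_mx_scalar.
rewrite /= (_ : _ + e%:M = (a * x + lin b (tcol t) + e)%:M)//.
by apply/matrixP => i j; rewrite !ord1 /lin !mxE eqxx !mulr1n.
Qed.


Let scalar_mx0 : (0 : R)%:M = 0 :> 'M[R]_1.
Proof. exact: raddf0. Qed.


Lemma act_upper n (b : 'rV[R]_n) (e : R) :
  measure_preserving (act (block_mx 1%:M b 0 1%:M : 'M[R]_(1 + n)) (col_mx e%:M 0)).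
Proof.
apply: (@measure_preserving_fiberr _ _ (fun t => lin b (tcol t) + e)).
  exact: measurable_act.
move=> x t; rewrite act_tcons mul1r scaler0 add0r mul1mx addr0 tcolK.
by rewrite addrA.
Qed.

Lemma act_lower n (c : 'cV[R]_n) (D : 'M[R]_n) (v : 'cV[R]_n) :
  (forall w, measure_preserving (act D w)) ->
  measure_preserving (act (block_mx 1%:M 0 c D : 'M[R]_(1 + n)) (col_mx 0 v)).
Proof.
move=> mp; apply: (@measure_preserving_fiberl _ _ (fun x => act D ((x : R) *: c + v))).
- exact: measurable_act.
- move=> x t; rewrite -scalar_mx0 act_tcons mul1r lin0l !addr0.
  by rewrite /act addrA (addrC (D *m _)).
- by move=> x; exact: mp.
Qed.

Lemma measure_preserving_translation n (v : 'cV[R]_n) : measure_preserving (act 1%:M v).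
Proof.
elim: n v => [|n IH] v.
  split; first exact: measurable_act.
  move=> X mX; congr (lebesgue_tuple _); apply/seteqP.
  by split=> t /=; rewrite (tuple0 (act _ _ _)) (tuple0 t).
have -> : act 1%:M v = act (block_mx 1%:M 0 0 1%:M : 'M[R]_(1 + n)) (col_mx 0 (dsubmx (v : 'cV[R]_(1 + n))))
    \o act (block_mx 1%:M 0 0 1%:M : 'M[R]_(1 + n)) (col_mx (usubmx (v : 'cV[R]_(1 + n)) 0 0)%:M 0).
  rewrite act_comp -scalar_mx_block !mul1mx add_col_mx addr0 add0r.
  by rewrite -(mx11_scalar (usubmx _)) vsubmxK.
apply: measure_preserving_comp; last exact: act_upper.
by apply: act_lower => w; exact: IH.
Qed.

(* With A = [[a, b], [c, D]]: if a = 1 then A is a lower shear, times 1 (+) (D - cb), times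
   an upper shear; an upper shear makes a = 1 if c <> 0, and a lower one makes
   c <> 0 otherwise. *)
Lemma measure_preserving_SL n (A : 'M[R]_n) (v : 'cV[R]_n) :
  \det A = 1 -> measure_preserving (act A v).
Proof.
elim: n A v => [|n IH] A v detA.
  have -> : A = 1%:M by apply/matrixP => i; case: (notF (ltn_ord i)).
  exact: measure_preserving_translation.
suff lin_mp (B : 'M[R]_(1 + n)) : \det B = 1 -> measure_preserving (act B 0).
  have -> : act A v = act 1%:M v \o act A 0.
    by rewrite act_comp !mul1mx add0r.
  apply: measure_preserving_comp; first exact: measure_preserving_translation.
  exact: lin_mp.
move=> {A v detA} detB; have [n0|n0] := posnP n.
  (* In dimension 1 there are no shears, and determinant 1 leaves only the identity. *)
  subst n; have -> : B = 1%:M by rewrite [B]mx11_scalar -det_mx11 detB.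
  exact: measure_preserving_translation.
have actM (A1 A2 : 'M[R]_(1 + n)) : measure_preserving (act A1 0) ->
    measure_preserving (act A2 0) -> measure_preserving (act (A1 *m A2) 0).
  move=> p1 p2; rewrite -[X in act _ X](mulmx0 _ A1) -[X in act _ X]addr0 -act_comp.
  exact: measure_preserving_comp p1 p2.
have up (b : 'rV[R]_n) : measure_preserving (act (block_mx 1%:M b 0 1%:M : 'M[R]_(1 + n)) 0).
  by rewrite -col_mx0 -scalar_mx0; exact: act_upper.
have lo (c : 'cV[R]_n) (D : 'M[R]_n) : \det D = 1 ->
    measure_preserving (act (block_mx 1%:M 0 c D : 'M[R]_(1 + n)) 0).
  by move=> detD; rewrite -col_mx0; apply: act_lower => w; exact: IH.
have case1 (b : 'rV[R]_n) (c : 'cV[R]_n) (D : 'M[R]_n) :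
    \det (block_mx 1%:M b c D : 'M[R]_(1 + n)) = 1 ->
    measure_preserving (act (block_mx 1%:M b c D : 'M[R]_(1 + n)) 0).
  have -> : (block_mx 1%:M b c D : 'M[R]_(1 + n)) =
      (block_mx 1%:M 0 c (D - c *m b)) *m (block_mx 1%:M b 0 1%:M).
    by rewrite mulmx_block !mul1mx !mulmx1 !mul0mx !mulmx0 !addr0 addrC subrK.
  rewrite det_mulmx det_lblock det_ublock !det1 !mulr1 mul1r => detD.
  by apply: actM => //; exact: lo.
have case2 (a : R) (b : 'rV[R]_n) (c : 'cV[R]_n) (D : 'M[R]_n) : c != 0 ->
    \det (block_mx a%:M b c D : 'M[R]_(1 + n)) = 1 ->
    measure_preserving (act (block_mx a%:M b c D : 'M[R]_(1 + n)) 0).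
  move=> /eqP c0 detB'.
  have [i ci] : exists i, c i 0 != 0.
    apply/existsP; rewrite -negb_forall; apply/negP => /forallP H; apply: c0.
    by apply/colP => i; rewrite mxE; apply/eqP.
  (* The upper shear by [u] turns the corner entry [a] into [a + u c = 1]. *)
  pose u : 'rV[R]_n := ((1 - a) / c i 0) *: delta_mx 0 i.
  have uc : u *m c = (1 - a)%:M.
    rewrite [u *m c]mx11_scalar; congr (_%:M).
    by rewrite -/(lin u c) /u linZl lin_delta divfK.
  have E : (block_mx a%:M b c D : 'M[R]_(1 + n)) =
      (block_mx 1%:M (- u) 0 1%:M) *m (block_mx 1%:M (b + u *m D) c D).
    rewrite mulmx_block !mul1mx !mul0mx !add0r !mulNmx uc addrK.
    by rewrite -raddfB /= opprB addrC subrK.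
  rewrite E; apply: actM; first exact: up.
  by apply: case1; move: detB'; rewrite E det_mulmx det_ublock !det1 !mul1r.
rewrite -[B]submxK [ulsubmx B]mx11_scalar.
set a := ulsubmx B 0 0; set b := ursubmx B; set c := dlsubmx B; set D := drsubmx B.
have detB' : \det (block_mx a%:M b c D : 'M[R]_(1 + n)) = 1.
  by rewrite -[a%:M]mx11_scalar submxK.
have [c0|] := eqVneq c 0; last by move=> c0; exact: case2.
have a0 : a != 0.
  apply: contra_eq_neq detB' => ->.
  by rewrite c0 scalar_mx0 det_ublock det_mx11 mxE mul0r eq_sym oner_neq0.
(* Adding the first row to all others fills the zero column below [a] with copies of [a]; it becomes
   nonzero because [n > 0]. *)
have E : (block_mx a%:M b c D : 'M[R]_(1 + n)) =
    (block_mx 1%:M 0 (- const_mx 1) 1%:M) *m (block_mx a%:M b (const_mx a) (D + const_mx 1 *m b)).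
  rewrite mulmx_block !mul1mx !mul0mx !addr0 !mulNmx mul_mx_scalar c0.
  congr block_mx.
    by apply/colP => i; rewrite !mxE mulr1 addNr.
  by rewrite addrC addrK.
rewrite E; apply: actM; first by apply: lo; rewrite det1.
apply: case2; last by move: detB'; rewrite E det_mulmx det_lblock !det1 !mul1r.
apply: contraNneq a0 => /colP/(_ (Ordinal n0)).
by rewrite !mxE => ->.
Qed.


(** * Volume of polytopes *)

Lemma measurable_tcol_preimage n (P : set 'cV[R]_n) : polytope P ->
  measurable (@tcol n @^-1` P).
Proof.
move=> /polytopeP[hs ->]; elim: hs => [|p hs IH].
  by rewrite (_ : _ @^-1` _ = setT)//; apply/seteqP; split.
rewrite polyhedron_cons preimage_setI; apply: measurableI => //.
have mf : measurable_fun setT (fun t : n.-tuple mR => lin p.1 (tcol t) : mR).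
  rewrite (_ : (fun _ => _) = fun t => \sum_j p.1 0 j * (tnth t j : R)).
    apply: measurable_sum => j.
    apply: measurable_realfun.measurable_funM => //; exact: measurable_tnth.
  by apply/funext => t; rewrite linE; apply: eq_bigr => j _; rewrite mxE.
have := mf measurableT _ (@measurable_itv R `]-oo, p.2]%R).
rewrite setTI; congr measurable; apply/seteqP; split=> t; by rewrite /halfspace /= in_itv.
Qed.

Lemma hull_bounded n (s : seq 'cV[R]_n) :
  exists2 M, 0 <= M & forall x i, hull s 1 x -> `|x i 0| <= M.
Proof.
have [M M0 HM] : exists2 M, 0 <= M & forall v i, v \in s -> `|v i 0| <= M.
  elim: s => [|v s [M M0 HM]]; first by exists 0.
  have sum0 : 0 <= \sum_i `|v i 0| by apply: sumr_ge0.
  exists (M + \sum_i `|v i 0|); first exact: addr_ge0.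
  move=> u i; rewrite inE => /orP[/eqP ->|/HM H].
    rewrite (bigD1 i)//= addrCA lerDl addr_ge0// sumr_ge0//.
  by rewrite (le_trans (H i))// lerDl.
exists M => // x i sx; rewrite ler_norml.
have H1 : {in s, forall v, lin (delta_mx 0 i) v <= M}.
  by move=> v vs; rewrite lin_delta (le_trans (ler_norm _))// HM.
have H2 : {in s, forall v, - M <= lin (delta_mx 0 i) v}.
  by move=> v vs; rewrite lin_delta; have := HM v i vs; rewrite ler_norml => /andP[].
by have := hull_lin_le H1 sx; have := hull_lin_ge H2 sx; rewrite !lin_delta !mulr1 => -> ->.
Qed.

Lemma lebesgue_tuple_polytope_fin n (P : set 'cV[R]_n) : polytope P ->
  (lebesgue_tuple (@tcol n @^-1` P) < +oo)%E.
Proof.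
move=> pP; have mP := measurable_tcol_preimage pP.
move/polytopeE: pP mP => [s ->] mP; have [M M0 HM] := hull_bounded s.
pose I (i : 'I_n) : set mR := `[- M, M]%classic.
have mI i : measurable (I i) by exact: measurable_itv.
have bE := lebesgue_tuple_box mI.
have [mu muE] := lebesgue_tuple_measure R n; rewrite muE in bE *.
apply: (@le_lt_trans _ _ (mu (box I))).
  apply: le_measure; rewrite ?inE//; first exact: measurable_box.
  by move=> t Pt i; rewrite /I /= in_itv /= -ler_norml; have := HM _ i Pt; rewrite mxE.
rewrite bE; suff : (\prod_i lambda (I i))%E \is a fin_num by rewrite fin_numElt => /andP[].
elim/big_ind: _ => // [x y|i _]; first exact: fin_numM.
by rewrite lebesgue_measure_itv /=; case: ifP.
Qed.

Lemma volumeE n (P : set 'cV[R]_n) :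
  volume P = fine (lebesgue_tuple (@tcol n @^-1` P)).
Proof. by []. Qed.

Lemma volume_ge0 n (P : set 'cV[R]_n) : 0 <= volume P.
Proof.
rewrite volumeE; have [mu ->] := lebesgue_tuple_measure R n.
exact/fine_ge0/measure_ge0.
Qed.

Lemma volume_valuation n : valuation (@polytope0 R n) (@volume R n).
Proof.
move=> P Q [pP _] [pQ _] [pI _] [pU _].
rewrite !volumeE preimage_setU preimage_setI.
have mP := measurable_tcol_preimage pP; have mQ := measurable_tcol_preimage pQ.
have fP := lebesgue_tuple_polytope_fin pP; have fQ := lebesgue_tuple_polytope_fin pQ.
have fI := lebesgue_tuple_polytope_fin pI; rewrite preimage_setI in fI.
have [mu muE] := lebesgue_tuple_measure R n; rewrite muE in fP fQ fI *.
have fin X : (mu X < +oo)%E -> mu X \is a fin_num by move=> ?; rewrite ge0_fin_numE.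
have /= -> := measureUfinr mP mQ fQ.
by rewrite fineB ?fineD ?fin_numD ?fin// subrK.
Qed.

(** The image under [A] is the preimage under its inverse, which also has determinant 1. *)
Lemma volume_SL n : SL_invariant (@polytope0 R n) (@volume R n).
Proof.
move=> A P detA [pP _].
have Au : A \in unitmx by rewrite unitmxE detA unitr1.
have detA' : \det (invmx A) = 1 by rewrite det_inv detA invr1.
rewrite !volumeE -((measure_preserving_SL 0 detA').2 _ (measurable_tcol_preimage pP)).
congr (fine (lebesgue_tuple _)); apply/seteqP; split=> t /=.
  move=> [x Px xt]; rewrite /act /= coltK addr0.
  by rewrite (_ : tcol t = A *m x)// mulKmx.
rewrite /act /= coltK addr0 => Pt; exists (invmx A *m tcol t) => //.
by rewrite mulKVmx.
Qed.

Lemma hull_sum_delta n (x : 'cV[R]_n) : (forall i, 0 <= x i 0) ->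
  hull [seq delta_mx i 0 | i <- enum 'I_n] (\sum_i x i 0) x.
Proof.
move=> x0; rewrite [X in hull _ _ X]matrix_sum_delta.
apply: hull_sum => i _; rewrite big_ord1; apply: hull_memZ => //.
by apply/mapP; exists i; rewrite ?mem_enum.
Qed.

(** The simplex contains the cube with side [1 / n] and a corner at 0. *)
Lemma volume_simplex_delta_gt0 n : (0 < n)%N ->
  0 < volume (simplex [seq delta_mx i 0 : 'cV[R]_n | i <- enum 'I_n]).
Proof.
move=> n0; set S := simplex _.
have [pS _] : polytope0 S by exact: polytope0_simplex.
have mS := measurable_tcol_preimage pS; have fS := lebesgue_tuple_polytope_fin pS.
pose I (i : 'I_n) : set mR := `[0, n%:R^-1]%classic.
have mI i : measurable (I i) by exact: measurable_itv.
have bE := lebesgue_tuple_box mI.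
have n0' : 0 < n%:R^-1 :> R by rewrite invr_gt0 ltr0n.
rewrite volumeE.
have [mu muE] := lebesgue_tuple_measure R n; rewrite muE in bE fS *.
apply: fine_gt0; rewrite fS andbT.
apply: (@lt_le_trans _ _ (mu (box I))).
  rewrite bE; elim/big_ind: _ => // [x y|i _]; first exact: mule_gt0.
  by rewrite lebesgue_measure_itv /= lte_fin n0' oppr0 addr0 lte_fin.
apply: le_measure; rewrite ?inE//; first exact: measurable_box.
move=> t It; apply/simplexP; exists (\sum_i tcol t i 0).
  apply: (@le_trans _ _ (\sum_(i < n) n%:R^-1)).
    by apply: ler_sum => i _; rewrite mxE; have := It i; rewrite /I /= in_itv /= => /andP[].
  by rewrite sumr_const card_ord -(mulr_natr n%:R^-1) mulVf// pnatr_eq0 -lt0n.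
apply: hull_sum_delta => i; rewrite mxE.
by have := It i; rewrite /I /= in_itv /= => /andP[].
Qed.

(** [P] lies in a box whose side number [j] is reduced to the point 0. *)
Lemma volume_coordinate_hyperplane n (j : 'I_n) (P : set 'cV[R]_n) : polytope P ->
  (forall x, P x -> x j 0 = 0) -> volume P = 0.
Proof.
move=> pP Pj; have [s sE] := (polytopeE P).1 pP; have [M M0 HM] := hull_bounded s.
have mP := measurable_tcol_preimage pP.
pose I (i : 'I_n) : set mR := if i == j then `[0, 0]%classic else `[- M, M]%classic.
have mI i : measurable (I i) by rewrite /I; case: ifP => _; exact: measurable_itv.
have bE := lebesgue_tuple_box mI.
rewrite volumeE.
have [mu muE] := lebesgue_tuple_measure R n; rewrite muE in bE *.
suff -> : mu (@tcol n @^-1` P) = 0 by [].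
apply/eqP; rewrite eq_le measure_ge0 andbT.
rewrite (_ : 0%E = mu (box I)).
  apply: le_measure; rewrite ?inE//; first exact: measurable_box.
  move=> t Pt i; rewrite /I; case: eqP => [->|_].
    by have := Pj _ Pt; rewrite mxE /= in_itv /= => ->; rewrite lexx.
  by move: Pt; rewrite /= sE => Pt; have := HM _ i Pt; rewrite mxE /= in_itv /= ler_norml.
by rewrite bE (bigD1 j)//= /I eqxx lebesgue_measure_itv /= ltxx mul0e.
Qed.

End lebesgue_SL.

(** * SL(n) invariant valuations on simplices with vertex 0 *)

Section SL_classes.
Context (R : realType) (n : nat).
Local Notation V := 'cV[R]_n.
Implicit Types (s r : seq V) (x y u v w : V) (a b c d e t : R).

Lemma hull_mulmx (A : 'M[R]_n) s c x : hull s c x -> hull [seq A *m v | v <- s] c (A *m x).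
Proof.
elim: s c x => [c x [-> ->]|v s IH c x /= [a a0 H]]; first by rewrite mulmx0.
by exists a => //; rewrite scalemxAr -mulmxBr; exact: IH.
Qed.

Lemma hull_map_mulmx (A : 'M[R]_n) s c y : hull [seq A *m v | v <- s] c y ->
  exists2 x, hull s c x & A *m x = y.
Proof.
elim: s c y => [c y [-> ->]|v s IH c y /= [a a0 /IH[x sx xy]]].
  by exists 0; rewrite ?mulmx0.
exists (x + a *: v); last by rewrite mulmxDr xy -scalemxAr subrK.
by exists a => //; rewrite addrK.
Qed.

Lemma mulmx_simplex (A : 'M[R]_n) s :
  mulmx A @` simplex s = simplex [seq A *m v | v <- s].
Proof.
apply/seteqP; split=> [_ [x /simplexP[c c1 sx] <-]|y /simplexP[c c1]].
  by apply/simplexP; exists c => //; exact: hull_mulmx.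
by move=> /hull_map_mulmx[x sx <-]; exists x => //; apply/simplexP; exists c.
Qed.

(** A list shorter than [n] is padded with zero rows, by the default value of [nth]. *)
Definition rows_mx s : 'M[R]_n := \matrix_(i, j) s`_i j 0.

Definition dets s : R := \det (rows_mx s).

Lemma rows_mx_mulmx (A : 'M[R]_n) s :
  rows_mx [seq A *m v | v <- s] = rows_mx s *m A^T.
Proof.
apply/matrixP => i j; rewrite !mxE; case: (ltnP i (size s)) => si.
  rewrite (nth_map 0)// mxE; apply: eq_bigr => k _.
  by rewrite !mxE mulrC.
rewrite nth_default ?size_map// mxE big1// => k _.
by rewrite !mxE nth_default// mxE mul0r.
Qed.

Lemma free_dets s : size s = n -> free s -> dets s != 0.
Proof.
move=> sn sfree; apply/det0P => -[v v0 vs]; move/eqP: v0; apply.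
have sn' : size s == n by rewrite sn.
have /freeP : free (Tuple sn') by [].
move=> /(_ (v 0)) H; apply/rowP => i; rewrite mxE; apply: H.
apply/colP => j; have /rowP/(_ j) := vs; rewrite summxE !mxE => vs0.
by rewrite -[RHS]vs0; apply: eq_bigr => k _; rewrite !mxE.
Qed.

Lemma dets_linear s r u v a b : (size s < n)%N ->
  dets (s ++ (a *: u + b *: v) :: r) = a * dets (s ++ u :: r) + b * dets (s ++ v :: r).
Proof.
move=> sn; have nth_other x y (i : 'I_n.-1) :
    (s ++ x :: r)`_(lift (Ordinal sn) i) = (s ++ y :: r)`_(lift (Ordinal sn) i).
  rewrite !nth_cat; case: ltngtP (neq_lift (Ordinal sn) i) => // [lt _|eq].
    by rewrite -(subnSK lt).
  by case/eqP; exact/val_inj.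
apply: (@determinant_multilinear _ _ _ _ _ (Ordinal sn)).
- apply/rowP => j; rewrite !mxE /= !nth_cat ltnn subnn /=.
  by rewrite !mxE.
- by apply/matrixP => i j; rewrite !mxE (nth_other _ 0) [in RHS](nth_other _ 0).
- by apply/matrixP => i j; rewrite !mxE (nth_other _ 0) [in RHS](nth_other _ 0).
Qed.

Lemma dets_scale u r a : (0 < n)%N -> dets (a *: u :: r) = a * dets (u :: r).
Proof.
move=> n0; have := @dets_linear [::] r u 0 a 0 n0.
by rewrite scaler0 addr0 mul0r addr0.
Qed.

Lemma dets_eq0 u r : (1 < n)%N -> dets [:: u, u & r] = 0.
Proof.
move=> n1; have n0 : (0 < n)%N by exact: ltnW.
apply: (@determinant_alternate _ _ _ (Ordinal n0) (Ordinal n1)) => // j.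
by rewrite !mxE.
Qed.

Lemma dets_cut_left u v r t : (1 < n)%N ->
  dets [:: u, (1 - t) *: u + t *: v & r] = t * dets [:: u, v & r].
Proof.
move=> n1; have := @dets_linear [:: u] r u v (1 - t) t n1.
by rewrite /= dets_eq0// mulr0 add0r.
Qed.

Lemma dets_cut_right u v r t : (1 < n)%N ->
  dets [:: (1 - t) *: u + t *: v, v & r] = (1 - t) * dets [:: u, v & r].
Proof.
move=> n1; have n0 : (0 < n)%N by exact: ltnW.
have := @dets_linear [::] (v :: r) u v (1 - t) t n0.
by rewrite /= dets_eq0// mulr0 addr0.
Qed.

Lemma dets_swap u v r : (1 < n)%N -> dets [:: v, u & r] = - dets [:: u, v & r].
Proof.
move=> n1; have n0 : (0 < n)%N by exact: ltnW.
have D := dets_eq0 (u + v) r n1.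
have := @dets_linear [::] (u + v :: r) u v 1 1 n0.
have := @dets_linear [:: u] r u v 1 1 n1; have := @dets_linear [:: v] r u v 1 1 n1.
rewrite !scale1r !mul1r /= D (dets_eq0 u)// (dets_eq0 v)//; lra.
Qed.

(** A basis of a complement is appended. As [size s < n] it has at least one vector, and rescaling
    that one makes the determinant 1. *)
Lemma free_extend s : free s -> (size s < n)%N ->
  exists r, [/\ size (s ++ r) = n, free (s ++ r) & dets (s ++ r) = 1].
Proof.
move=> sfree sn.
pose r := vbasis (<< s >>^C)%VS.
have srb : basis_of fullv (s ++ r).
  rewrite -(addv_complf << s >>%VS); apply: cat_basis.
  - by apply/directv_addP; exact: capv_compl.
  - by rewrite /basis_of eqxx sfree.
  - exact: vbasisP.
have srn : size (s ++ r) == n.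
  by have := @size_basis _ _ _ _ (in_tuple (s ++ r)) srb; rewrite dimvf /dim /= muln1 => <-.
have srfree := basis_free srb.
case rE : (r : seq _) => [|x r'].
  by move: srn; rewrite rE cats0 ltn_eqF.
move: srn srfree; rewrite rE => /eqP srn srfree.
have d0 := free_dets srn srfree.
exists ((dets (s ++ x :: r'))^-1 *: x :: r'); split.
- by apply: etrans srn; rewrite !size_cat.
- have pE y : perm_eq (s ++ y :: r') (y :: (s ++ r')) by apply/permPl; exact: (perm_catCA s [:: y] r').
  move: srfree; rewrite !(perm_free (pE _)); apply: (@free_replace _ _ _ _ _ (dets (s ++ x :: r'))^-1).
    by rewrite invr_eq0.
  by rewrite subrr mem0v.
have := @dets_linear s r' x 0 (dets (s ++ x :: r'))^-1 0 sn.
by rewrite scaler0 addr0 mul0r addr0 mulVf.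
Qed.

Lemma exists_SL s r : size s = n -> size r = n -> free s -> dets s = dets r ->
  exists2 A : 'M[R]_n, \det A = 1 & [seq A *m v | v <- s] = r.
Proof.
move=> sn rn sfree sr.
have s0 := free_dets sn sfree.
have su : rows_mx s \in unitmx by rewrite unitmxE unitfE.
(* [A] acts on rows through its transpose, so this one sends [s] to [r]; equality of the
   determinants gives it determinant 1. *)
pose A := (invmx (rows_mx s) *m rows_mx r)^T; exists A.
  by rewrite det_tr det_mulmx det_inv -/(dets s) -/(dets r) -sr mulVf.
apply: (@eq_from_nth _ 0); rewrite size_map sn// => i isn.
have := rows_mx_mulmx A s; rewrite trmxK mulKVmx// => /matrixP/(_ (Ordinal isn)) H.
by apply/colP => j; have := H j; rewrite !mxE.
Qed.

End SL_classes.

Section SL_valuations.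
Context (R : realType) (n : nat).
Local Notation V := 'cV[R]_n.
Implicit Types (s r : seq V) (x y u v w : V) (a b c d e t : R).

Variable Psi : set V -> R.
Hypotheses (n_gt1 : (1 < n)%N) (Psi_val : valuation (@polytope0 R n) Psi)
  (Psi_SL : SL_invariant (@polytope0 R n) Psi).

Lemma SL_simplex_eq s r : size s = n -> size r = n -> free s ->
  dets s = dets r -> Psi (simplex s) = Psi (simplex r).
Proof.
move=> sn rn sfree sr; have [A detA <-] := exists_SL sn rn sfree sr.
by rewrite -mulmx_simplex Psi_SL//; exact: polytope0_simplex.
Qed.

(** Below full size both lists extend to bases of determinant 1, and the matrix carrying one basis
    to the other carries [s] to [r]. *)
Lemma SL_simplex_low s r : free s -> free r -> size s = size r -> (size s < n)%N ->
  Psi (simplex s) = Psi (simplex r).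
Proof.
move=> sfree rfree sr sn.
have [s' [s'n s'free s'1]] := free_extend sfree sn.
have [|r' [r'n r'free r'1]] := free_extend rfree; first by rewrite -sr.
have [|A detA AE] := exists_SL s'n r'n s'free; first by rewrite s'1 r'1.
suff <- : [seq A *m v | v <- s] = r.
  by rewrite -mulmx_simplex Psi_SL//; exact: polytope0_simplex.
have := congr1 (take (size s)) AE.
by rewrite map_cat take_size_cat ?size_map// sr take_size_cat.
Qed.

Lemma simplex_cut_val u v r t : 0 < t -> t < 1 -> free [:: u, v & r] ->
  let w := (1 - t) *: u + t *: v in
  Psi (simplex [:: u, v & r]) + Psi (simplex (w :: r)) =
  Psi (simplex [:: u, w & r]) + Psi (simplex [:: w, v & r]).
Proof.
move=> t0 t1 uvfree w.
have := Psi_val (polytope0_simplex [:: u, w & r]) (polytope0_simplex [:: w, v & r]).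
rewrite simplex_cutI// -simplex_cutU// => -> //; exact: polytope0_simplex.
Qed.

(* Halving an edge of a k-simplex gives f_k + f_(k-1) = 2 f_k for the common value
   f_k of Psi on the k-simplices with vertex 0, k < n. *)
Lemma simplex_low_const s u : free s -> (0 < size s < n)%N -> u != 0 ->
  Psi (simplex s) = Psi (simplex [:: u]).
Proof.
move=> + + u0; have [k] := ubnP (size s); elim: k s => // k IH s.
case: s => [//|x [|y r]] sk sfree /andP[_ sn].
  by apply: SL_simplex_low => //; rewrite seq1_free.
have h0 : 0 < 2^-1 :> R by lra.
have h1 : 2^-1 < 1 :> R by lra.
have := simplex_cut_val h0 h1 sfree; set w := _ + _ => /= E.
have wfree : free (w :: r) := free_cut_mid h0 sfree.
have E1 : Psi (simplex [:: x, w & r]) = Psi (simplex [:: x, y & r]).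
  by apply: SL_simplex_low => //; exact: free_cut_left.
have E2 : Psi (simplex [:: w, y & r]) = Psi (simplex [:: x, y & r]).
  by apply: SL_simplex_low => //; exact: free_cut_right.
rewrite -(IH (w :: r))//; first by move: E; rewrite E1 E2; lra.
by rewrite /= ltnW.
Qed.

(** Exchanging two vertices changes the sign of the determinant but not the simplex, so only the
    absolute value matters. *)
Lemma simplex_full s (e : V) r : free s -> size s = n -> free (e :: r) -> size (e :: r) = n ->
  dets (e :: r) = 1 -> Psi (simplex s) = Psi (simplex (`|dets s| *: e :: r)).
Proof.
move=> sfree sn efree en e1.
have n0 : (0 < n)%N by exact: ltnW.
have [d0|d0] := leP 0 (dets s).
  by apply: SL_simplex_eq => //; rewrite dets_scale// e1 mulr1 ger0_norm.
have : (1 < size s)%N by rewrite sn.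
case: s sfree sn d0 => [|x [|y s]] // sfree sn d0 _.
have -> : simplex [:: x, y & s] = simplex [:: y, x & s].
  by apply: simplex_eq => z; rewrite !inE orbCA.
apply: SL_simplex_eq => //; first by rewrite free_swap.
by rewrite dets_scale// e1 mulr1 ltr0_norm// dets_swap.
Qed.

Lemma simplex_cauchy (e : V) r u a b : free (e :: r) -> size (e :: r) = n -> u != 0 ->
  dets (e :: r) = 1 -> 0 < a -> 0 < b ->
  Psi (simplex ((a + b) *: e :: r)) + Psi (simplex [:: u]) =
  Psi (simplex (a *: e :: r)) + Psi (simplex (b *: e :: r)).
Proof.
move=> efree en u0 e1 a0 b0; have n0 : (0 < n)%N by exact: ltnW.
have : (1 < size (e :: r))%N by rewrite en.
case: r efree en e1 => [|v r] // efree en e1 _.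
have ab0 : 0 < a + b by exact: addr_gt0.
(* With this ratio the two pieces have determinants [a] and [b]; their common face [w :: r] is of
   lower dimension and takes the constant value. *)
pose t := a / (a + b).
have t0 : 0 < t by exact: divr_gt0.
have t1 : t < 1 by rewrite ltr_pdivrMr//; lra.
have abfree : free [:: (a + b) *: e, v & r].
  apply: (free_replace _ _ efree (a := a + b)); first by rewrite gt_eqF.
  by rewrite subrr mem0v.
have := simplex_cut_val t0 t1 abfree; set w := _ + _ => /= E.
have d : dets [:: (a + b) *: e, v & r] = a + b by rewrite dets_scale// e1 mulr1.
rewrite -(simplex_low_const (s := w :: r) _ _ u0).
- rewrite E (simplex_full (free_cut_left t0 abfree) _ efree en e1)//.
  rewrite (simplex_full (free_cut_right t1 abfree) _ efree en e1)//.
  rewrite dets_cut_left// dets_cut_right// d.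
  have -> : t * (a + b) = a by rewrite divfK// gt_eqF.
  have -> : (1 - t) * (a + b) = b by rewrite /t; field; rewrite gt_eqF.
  by rewrite !gtr0_norm.
- exact: (free_cut_mid t0 abfree).
- exact: eq_leq en.
Qed.

End SL_valuations.

(** Nonnegativity makes [f] monotone, so [f (m * a)] and [m * a * f 1] lie between the same
    consecutive multiples of [f 1]. Hence [m * (f a - a * f 1)] stays bounded as [m] grows. This is
    applied to the volume as a function of the determinant. *)
Lemma additive_ge0_linear (R : realType) (f : R -> R) :
  (forall a b, 0 < a -> 0 < b -> f (a + b) = f a + f b) ->
  (forall a, 0 < a -> 0 <= f a) -> forall a, 0 < a -> f a = a * f 1.
Proof.
move=> fD f0 a a0.
have mono x y : 0 < x -> x <= y -> f x <= f y.
  move=> x0; rewrite le_eqVlt => /orP[/eqP -> //|xy].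
  by rewrite -(subrK x y) fD ?subr_gt0// lerDr f0// subr_gt0.
have fM m x : 0 < x -> f (m.+1%:R * x) = m.+1%:R * f x.
  move=> x0; elim: m => [|m IH]; first by rewrite !mul1r.
  rewrite -[m.+2]addn1 natrD !mulrDl !mul1r fD ?IH// mulr_gt0//.
have fN m : f m.+1%:R = m.+1%:R * f 1 by rewrite -fM// mulr1.
have f1 := f0 1 ltr01.
have key m : `|m.+1%:R * (f a - a * f 1)| <= f 1.
  have ma0 : 0 < m.+1%:R * a by rewrite mulr_gt0.
  have /andP[k1 k2] : (Num.trunc (m.+1%:R * a))%:R <= m.+1%:R * a < (Num.trunc (m.+1%:R * a)).+1%:R.
    by rewrite truncn_itv// ltW.
  set k := Num.trunc _ in k1 k2.
  have U : f (m.+1%:R * a) <= k%:R * f 1 + f 1.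
    by rewrite (le_trans (mono _ _ ma0 (ltW k2)))// fN -natr1 mulrDl mul1r.
  have L : k%:R * f 1 <= f (m.+1%:R * a).
    case: (k) k1 => [|k'] k1; first by rewrite mul0r f0.
    by rewrite -fN; apply: mono.
  have := ler_wpM2r f1 k1; have := ler_wpM2r f1 (ltW k2).
  rewrite -natr1 mulrDl mul1r => A B.
  rewrite fM// in U L; rewrite ler_norml; apply/andP; split; lra.
apply/eqP; rewrite -subr_eq0; apply/negPn/negP; rewrite -normr_gt0 => E.
pose m := Num.trunc (f 1 / `|f a - a * f 1|).
have := key m; rewrite normrM ger0_norm// -ler_pdivlMr//.
by rewrite leNgt truncnS_gt.
Qed.

(** * The relative interior functional *)

Section polyhedral_cones.
Context (R : realType) (n : nat).
Local Notation V := 'cV[R]_n.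
Implicit Types (x y z u v w : V) (L : seq 'rV[R]_n) (a b c d e t : R).

Definition symmetric_cone (C : set V) := forall x, C x -> C (- x).

Definition polyhedral_cone (C : set V) :=
  exists L, C = [set x | {in L, forall l, lin l x <= 0}].

Lemma coneD (C : set V) x y : polyhedral_cone C -> C x -> C y -> C (x + y).
Proof. by move=> [L ->] Cx Cy l lL; rewrite linD; have := Cx l lL; have := Cy l lL; lra. Qed.

Lemma coneZ (C : set V) a x : polyhedral_cone C -> 0 <= a -> C x -> C (a *: x).
Proof. by move=> [L ->] a0 Cx l lL; rewrite linZ mulr_ge0_le0// Cx. Qed.

Lemma cone0 (C : set V) : polyhedral_cone C -> C 0.
Proof. by move=> [L ->] l lL; rewrite lin0. Qed.

(** An inequality violated at [y] is still violated at [y + e *: z] for small [e]. *)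
Lemma cone_limit (C : set V) y z : polyhedral_cone C ->
  (forall e, 0 < e -> C (y + e *: z)) -> C y.
Proof.
move=> [L ->] H l lL; rewrite leNgt; apply/negP => ly.
have := H (lin l y / (2 * (`|lin l z| + 1))) _ l lL.
have n0 := normr_ge0 (lin l z).
have e0 : 0 < lin l y / (2 * (`|lin l z| + 1)) by apply: divr_gt0 => //; lra.
move=> /(_ e0); rewrite linD linZ.
have : lin l y / (2 * (`|lin l z| + 1)) * `|lin l z| <= lin l y / 2.
  rewrite mulrAC ler_pdivrMr; last lra.
  rewrite -mulrA ler_pM2l//; lra.
have : - `|lin l z| <= lin l z by rewrite lerNl -normrN ler_norm.
move/(ler_wpM2l (ltW e0)); lra.
Qed.

(** Scaling [z + e^-1 *: y] by [e] gives [y + e *: z], which tends to [y]. *)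
Lemma cone_limit_dir (C : set V) y z : polyhedral_cone C ->
  (forall t, 0 < t -> C (z + t *: y)) -> C y.
Proof.
move=> pC H; apply: (@cone_limit _ _ z) => // e e0.
have ie0 : 0 < e^-1 by rewrite invr_gt0.
have := coneZ pC (ltW e0) (H _ ie0).
by rewrite scalerDr scalerA divff ?gt_eqF// scale1r addrC.
Qed.

(* The ray x + t y leaves the cone at the time t, through the facet l. *)
Lemma exit_time L x y : {in L, forall l, lin l x <= 0} ->
  {in L, forall l, lin l y <= 0} \/
  exists t, [/\ 0 <= t, {in L, forall l, lin l (x + t *: y) <= 0} &
    exists2 l, l \in L & lin l (x + t *: y) = 0 /\ 0 < lin l y].
Proof.
elim: L => [|l L IH] Lx; first by left.
have lx := Lx l (mem_head _ _).
have {Lx} Lx : {in L, forall l, lin l x <= 0} by move=> k kL; apply: Lx; rewrite inE kL orbT.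
pose t' := - lin l x / lin l y.
have t'0 : 0 < lin l y -> 0 <= t' by move=> ly; apply: divr_ge0; lra.
have t'E : 0 < lin l y -> lin l (x + t' *: y) = 0.
  by move=> ly; rewrite linD linZ /t'; field; rewrite gt_eqF.
have [Ly|[t [t0 Lt [k kL [kt ky]]]]] := IH Lx.
  have [ly|ly] := leP (lin l y) 0.
    by left => k; rewrite inE => /orP[/eqP ->|/Ly].
  right; exists t'; split; first exact: t'0.
    move=> k; rewrite inE => /orP[/eqP ->|kL]; first by rewrite t'E.
    by rewrite linD linZ; have := mulr_ge0_le0 (t'0 ly) (Ly k kL); have := Lx k kL; lra.
  by exists l; rewrite ?mem_head// t'E.
right; have [lt|lt] := leP (lin l (x + t *: y)) 0.
  exists t; split=> //; first by move=> j; rewrite inE => /orP[/eqP ->|/Lt].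
  by exists k; rewrite ?inE ?kL ?orbT.
have ly : 0 < lin l y.
  rewrite ltNge; apply/negP => ly; move: lt; rewrite linD linZ.
  have := mulr_ge0_le0 t0 ly; lra.
have t't : t' <= t.
  by rewrite ler_pdivrMr//; move: lt; rewrite linD linZ; lra.
exists t'; split; first exact: t'0.
  move=> j; rewrite inE => /orP[/eqP ->|jL]; first by rewrite t'E.
  have := Lt j jL; have := Lx j jL; rewrite !linD !linZ => jx.
  have [jy|jy] := leP (lin j y) 0; first by have := mulr_ge0_le0 (t'0 ly) jy; lra.
  by have := ler_wpM2r (ltW jy) t't; lra.
by exists l; rewrite ?mem_head// t'E.
Qed.

(** * Two polyhedral cones with convex union, convexity being expressed by [CUD] *)

Section two_cones.
Variables C D : set V.
Hypotheses (pC : polyhedral_cone C) (pD : polyhedral_cone D).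
Hypothesis CUD : forall x y, C x -> D y -> (C `|` D) (x + y).

(** The ray from [x] in direction [y] must leave [C], since [y] is not in [C]. Just past the exit it
    lies in [D], hence so does the exit point, [D] being closed; [t > 0] because [x] is not in
    [D]. *)
Lemma cones_meet x y : C x -> ~ D x -> D y -> ~ C y ->
  exists2 t, 0 < t & (C `&` D) (x + t *: y).
Proof.
move=> Cx Dx Dy Cy; case: (pC) => L CE.
have [|Ly|[t [t0 Lt [l lL [lt ly]]]]] := @exit_time L x y.
- by move: Cx; rewrite CE.
- by exfalso; apply: Cy; rewrite CE.
have Dt : D (x + t *: y).
  apply: (@cone_limit _ _ y) => // e e0; rewrite -addrA -scalerDl.
  have te0 : 0 <= t + e by lra.
  have [|//] := CUD Cx (coneZ pD te0 Dy).
  rewrite CE => /(_ l lL); rewrite scalerDl addrA linD lt add0r linZ.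
  by rewrite pmulr_rle0// leNgt ly.
exists t; last by split => //; rewrite CE.
rewrite lt_def t0 andbT; apply/eqP => t00; apply: Dx.
by move: Dt; rewrite t00 scale0r addr0.
Qed.

(** If [C] were symmetric, [y + t *: x] in [C] would put [y] in [C]. So these points all lie in [D],
    and so does their limit direction [x]. *)
Lemma not_symmetric_cone x y : C x -> ~ D x -> D y -> ~ C y -> ~ symmetric_cone C.
Proof.
move=> Cx Dx Dy Cy symC; apply: Dx; apply: (@cone_limit_dir _ _ y) => // t t0.
have Ctx := coneZ pC (ltW t0) Cx.
have [|] := CUD Ctx Dy; rewrite addrC// => Cyx; exfalso; apply: Cy.
by rewrite -(addrK (t *: x) y); apply: coneD => //; exact: symC.
Qed.

(** If [- x] is in [C], then [y - t *: x] is not in [C], as adding [t *: x] would put [y] there. It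
    is thus in [D] for all [t > 0], and so is the limit direction [- x]. *)
Lemma symmetric_coneU_opp x y : D y -> ~ C y -> symmetric_cone (C `|` D) ->
  (C `&` D) x -> D (- x).
Proof.
move=> Dy Cy symU [Cx Dx]; have [|//] : (C `|` D) (- x) by apply: symU; left.
move=> Cx'; apply: (@cone_limit_dir _ _ y) => // t t0.
have Ctx := coneZ pC (ltW t0) Cx'.
have [|] := CUD Ctx Dy; rewrite addrC// => Cyx; exfalso; apply: Cy.
rewrite -(subrK (t *: x) y) -scalerN; apply: coneD => //.
exact: coneZ (ltW t0) Cx.
Qed.

(** The opposite of a meeting point [x + t *: y] lies in [D]; adding [t *: y] leaves [- x]. *)
Lemma symmetric_coneI_opp x y : C x -> ~ D x -> D y -> ~ C y ->
  symmetric_cone (C `&` D) -> D (- x).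
Proof.
move=> Cx Dx Dy Cy symI; have [t t0 /symI[_ Dt]] := cones_meet Cx Dx Dy Cy.
rewrite (_ : - x = - (x + t *: y) + t *: y); last by rewrite opprD subrK.
by apply: coneD => //; exact: coneZ (ltW t0) Dy.
Qed.

End two_cones.

Section incomparable_cones.
Variables (C D : set V) (x y : V).
Hypotheses (pC : polyhedral_cone C) (pD : polyhedral_cone D).
Hypothesis CUD : forall x y, C x -> D y -> (C `|` D) (x + y).
Hypotheses (Cx : C x) (Dx : ~ D x) (Dy : D y) (Cy : ~ C y).

Let DUC u v : D u -> C v -> (D `|` C) (u + v).
Proof. by move=> Du Cv; rewrite setUC addrC; exact: CUD. Qed.

Lemma incomparable_not_symmetric : ~ symmetric_cone C /\ ~ symmetric_cone D.
Proof.
split; first exact: not_symmetric_cone CUD _ _ Cx Dx Dy Cy.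
exact: not_symmetric_cone DUC _ _ Dy Cy Cx Dx.
Qed.

Lemma symmetric_coneUI : symmetric_cone (C `|` D) <-> symmetric_cone (C `&` D).
Proof.
split=> [symU z [Cz Dz]|symI z].
  split; last by apply: (symmetric_coneU_opp pC pD CUD Dy Cy symU).
  by apply: (symmetric_coneU_opp pD pC DUC Cx Dx); rewrite 1?setUC.
have [Cz|Cz] := pselect (C z); have [Dz|Dz] := pselect (D z); try by case.
- by move=> _; left; case: (symI z).
- by move=> _; right; exact: (symmetric_coneI_opp pC pD CUD Cz Dz Dy Cy).
- move=> _; left; apply: (symmetric_coneI_opp pD pC DUC Dz Cz Cx Dx).
  by rewrite setIC.
Qed.

(** The union is spanned by the intersection and the single vector [x]: the ray from [x] towards any
    [z] in [D] but not in [C] meets the intersection, so [z] is in [WI + <[x]>]. *)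
Lemma dim_coneU (WU WI : {vspace V}) : C `|` D = [set` WU] -> C `&` D = [set` WI] ->
  \dim WU = (\dim WI).+1.
Proof.
move=> UE IE.
have inU z : (C `|` D) z <-> z \in WU by rewrite UE.
have inI z : (C `&` D) z <-> z \in WI by rewrite IE.
have xI : x \notin WI by apply/negP => /inI[].
have xW : x \in (WI + <[x]>)%VS by apply: (subvP (addvSr _ _)); exact: memv_line.
have IW z : z \in WI -> z \in (WI + <[x]>)%VS by apply/subvP; exact: addvSl.
have DW z : D z -> ~ C z -> z \in (WI + <[x]>)%VS.
  move=> Dz Cz; have [t t0 /inI/IW H] := cones_meet pC pD CUD Cx Dx Dz Cz.
  have : t *: z \in (WI + <[x]>)%VS by rewrite -[t *: z](addKr x) memvD// memvN.
  by rewrite rpredZeq gt_eqF.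
have -> : WU = (WI + <[x]>)%VS.
  apply/eqP; rewrite eqEsubv; apply/andP; split; apply/subvP => z.
    move=> /inU; have [Cz|Cz] := pselect (C z); last by case=> // Dz; exact: DW.
    have [Dz _|Dz _] := pselect (D z); first by apply: IW; apply/inI.
    (* For [z] in [C] but not in [D], the ray towards [y] is used, [y] being covered by [DW]. *)
    have [t t0 /inI/IW H] := cones_meet pC pD CUD Cz Dz Dy Cy.
    rewrite -(addrK (t *: y) z) memvB// memvZ//; exact: DW.
  move=> /memv_addP[u /inI[Cu Du] [v /vlineP[k ->] ->]].
  apply: memvD; first by apply/inU; left.
  by apply: memvZ; apply/inU; left.
rewrite dimv_disjoint_sum ?dim_vline; last first.
  apply/eqP; rewrite -subv0; apply/subvP => z; rewrite memv_cap => /andP[zI /vlineP[k zE]].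
  move: zI; rewrite zE rpredZeq (negbTE xI) orbF => /eqP ->.
  by rewrite scale0r mem0v.
rewrite (_ : x != 0) ?addn1//.
by apply/eqP => x0; apply: Dx; rewrite x0; exact: cone0.
Qed.

End incomparable_cones.
End polyhedral_cones.

(** * The tangent cone at 0 and the relative interior term *)

Section relint_functional.
Context (R : realType) (n : nat).
Local Notation V := 'cV[R]_n.
Implicit Types (P Q : set V) (x y z u v w : V) (a b c d e t : R).

(* The tangent cone of P at 0, on which the relative interior term depends only. *)
Definition cone_of P : set V := [set x | exists2 e, 0 < e & P (e *: x)].

Lemma polytope0_scale P x e : polytope0 P -> P x -> 0 <= e -> e <= 1 -> P (e *: x).
Proof.
move=> [/polytopeE[s ->] P0] Px e0 e1.
have e1' : 0 <= 1 - e by lra.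
by have := hullD (hullZ e0 Px) (hullZ e1' P0); rewrite !mulr1 scaler0 addr0 addrC subrK.
Qed.

(** Only the constraints tight at 0 restrict directions; the finitely many others hold for all small
    multiples of [x]. *)
Lemma polyhedral_cone_of P : polytope0 P -> polyhedral_cone (cone_of P).
Proof.
move=> /polytope0P[hs h0 ->].
exists [seq p.1 | p <- [seq p <- hs | p.2 == 0]]; apply/seteqP; split=> x.
  move=> [e e0 Px] l /mapP[p]; rewrite mem_filter => /andP[/eqP p0 ps] ->.
  by have := Px p ps; rewrite /halfspace /= p0 linZ pmulr_rle0.
move=> H.
suff [e e0 He] : exists2 e, 0 < e & {in hs, forall p, forall e', 0 < e' -> e' <= e -> e' * lin p.1 x <= p.2}.
  by exists e => // p ps; rewrite /halfspace /= linZ He.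
have {H} : {in hs, forall p, p.2 = 0 -> lin p.1 x <= 0}.
  by move=> p ps p0; apply: H; apply/mapP; exists p; rewrite // mem_filter p0 eqxx.
elim: hs h0 => [|p hs IH] h0 H; first by exists 1.
have [||e e0 He] := IH.
- by move=> q qs; apply: h0; rewrite inE qs orbT.
- by move=> q qs; apply: H; rewrite inE qs orbT.
have p0 := h0 p (mem_head _ _); have Hp := H p (mem_head _ _).
have [px|px] := leP (lin p.1 x) 0.
  exists e => // q; rewrite inE => /orP[/eqP -> e' e'0 _|/He//].
  by apply: le_trans p0; rewrite pmulr_rle0.
have {}p0 : 0 < p.2.
  by rewrite lt_def p0 andbT; apply/eqP => /Hp; lra.
exists (Num.min e (p.2 / lin p.1 x)); first by rewrite lt_min e0 divr_gt0.
move=> q; rewrite inE => /orP[/eqP -> e' e'0|/He H' e' e'0]; rewrite le_min => /andP[ee ep].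
  by rewrite -ler_pdivlMr.
exact: H'.
Qed.

Lemma sub_cone_of P x : P x -> cone_of P x.
Proof. by exists 1; rewrite ?scale1r. Qed.

Lemma cone_ofU P Q : cone_of (P `|` Q) = cone_of P `|` cone_of Q.
Proof.
apply/seteqP; split=> x.
  by move=> [e e0 [Px|Qx]]; [left|right]; exists e.
by move=> [[e e0 Px]|[e e0 Qx]]; exists e => //; [left|right].
Qed.

(** Both sets are star-shaped about 0, so the smaller of the two scales serves for both. *)
Lemma cone_ofI P Q : polytope0 P -> polytope0 Q ->
  cone_of (P `&` Q) = cone_of P `&` cone_of Q.
Proof.
move=> pP pQ; apply/seteqP; split=> x.
  by move=> [e e0 [Px Qx]]; split; exists e.
move=> [[e e0 Px] [d d0 Qx]]; exists (Num.min e d); first by rewrite lt_min e0.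
have scale S c : polytope0 S -> 0 < c -> S (c *: x) -> Num.min e d <= c -> S (Num.min e d *: x).
  move=> pS c0 Sx le.
  rewrite -(divfK (lt0r_neq0 c0) (Num.min e d)) -scalerA; apply: polytope0_scale => //.
    by rewrite divr_ge0 ?ltW// lt_min e0.
  by rewrite ler_pdivrMr// mul1r.
by split; [apply: (scale P e)|apply: (scale Q d)] => //; rewrite ge_min lexx ?orbT.
Qed.

(** [xget] returns an unspecified witness, so every translate [x + W'] equal to [W] must be shown to
    have [W' = W]. *)
Lemma aff_dimE P (W : {vspace V}) : aff_hull P = [set` W] -> aff_dim P = \dim W.
Proof.
move=> PW; apply: xget_subset1.
  exists 0, W; split => //; rewrite PW; apply/seteqP; split=> x.
    by move=> Wx; exists x; rewrite ?add0r.
  by move=> [w Ww <-]; rewrite add0r.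
suff H (d : nat) : (exists x (W' : {vspace V}), aff_hull P = [set x + w | w in [set` W']] /\ \dim W' = d) -> d = \dim W.
  by move=> d d' /H -> /H ->.
move=> [x [W' [E <-]]]; congr (\dim _); rewrite PW in E.
have inW z : z \in W <-> exists2 w, w \in W' & x + w = z.
  have : (z \in W) = ([set` W] z) :> Prop by [].
  by rewrite E => ->.
have xW : x \in W by apply/inW; exists 0; rewrite ?mem0v ?addr0.
apply/eqP; rewrite eqEsubv; apply/andP; split; apply/subvP => z zW.
  by rewrite -[z](addKr x) memvD ?memvN//; apply/inW; exists z.
have /inW[w wW'] : x + z \in W by rewrite memvD.
by move/addrI <-.
Qed.

(** [W] is the span of the vertices. When the cone is symmetric, negative coefficients are allowed
    as well, so it fills [W]. *)
Lemma polytope0_aff_hull P : polytope0 P -> exists W : {vspace V},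
  [/\ aff_hull P = [set` W], forall x, cone_of P x -> x \in W
    & symmetric_cone (cone_of P) -> forall x, x \in W -> cone_of P x].
Proof.
move=> pP; have [/polytopeE[s sE] P0] := pP; exists << s >>%VS.
have PW x : P x -> x \in << s >>%VS by rewrite sE; exact: hull_span.
split.
- apply/seteqP; split=> x.
    move=> [k [v [a [Pv _ ->]]]] /=; apply: memv_suml => i _.
    by apply: memvZ; apply: PW.
  move=> /= xs; rewrite (coord_span (X := in_tuple s) xs).
  (* The extra point 0 takes the weight missing from 1. *)
  exists (size s).+1, (fun i => if unlift ord0 i is Some j then s`_j else 0),
    (fun i => if unlift ord0 i is Some j then coord (in_tuple s) j x
      else 1 - \sum_j coord (in_tuple s) j x); split.
  + move=> i; case: unliftP => [j _|_] //; rewrite sE; apply: hull_mem.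
    exact: mem_nth.
  + rewrite big_ord_recl unlift_none.
    by under [X in _ + X]eq_bigr do rewrite liftK; rewrite subrK.
  + rewrite big_ord_recl unlift_none scaler0 add0r.
    by apply: eq_bigr => i _; rewrite liftK.
- move=> x [e e0 /PW]; by rewrite rpredZeq gt_eqF.
- move=> sym x xs; rewrite (coord_span (X := in_tuple s) xs); have pC := polyhedral_cone_of pP.
  elim/big_ind: _ => [|y z|i _]; first exact: cone0.
    exact: coneD.
  have Cs : cone_of P s`_i by apply: sub_cone_of; rewrite sE; apply/hull_mem/mem_nth.
  have [a0|a0] := leP 0 (coord (in_tuple s) i x); first exact: coneZ.
  rewrite -[_ *: _]opprK -scaleNr; apply: sym; apply: coneZ => //; lra.
Qed.

(** If 0 is interior, small multiples of [- x] stay in [P]. Conversely a symmetric cone is all of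
    [W], so the constraints with bound 0 hold on [W], and the finitely many with positive bound hold
    near 0. *)
Lemma relint0P P : polytope0 P -> relint P 0 <-> symmetric_cone (cone_of P).
Proof.
move=> pP; have [W [AE CW WC]] := polytope0_aff_hull pP.
have A0 : aff_hull P 0 by rewrite AE /=; exact: mem0v.
(* The subspace topology is unfolded into max-norm balls inside [W]. *)
have -> : relint P 0 <-> exists2 e, 0 < e & forall x, (forall i, `|x i 0| < e) -> x \in W -> P x.
  have -> : relint P 0 = within (aff_hull P) (nbhs (0 : V)) P.
    by rewrite (nbhs_subspace_in A0).
  rewrite /within /=; split.
    move=> /nbhs_ballP[e /= e0 H]; exists e => // x xe Wx; apply: H; last by rewrite AE.
    split => // i j; rewrite ord1 /ball /= mxE sub0r normrN; exact: xe.
  move=> [e e0 H]; apply/nbhs_ballP; exists e => //= x [_ xe]; rewrite AE /= => Wx.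
  apply: H => // i; have := xe i 0; by rewrite /ball /= mxE sub0r normrN.
split.
  move=> [e e0 H] x Cx; have s0 : 0 <= \sum_i `|x i 0| by apply: sumr_ge0.
  pose d := e / (1 + \sum_i `|x i 0|).
  have d0 : 0 < d by apply: divr_gt0 => //; lra.
  exists d => //; apply: H => [i|]; last by rewrite memvZ// memvN CW.
  rewrite !mxE normrM normrN gtr0_norm// mulrAC ltr_pdivrMr; last lra.
  rewrite ltr_pM2l// (bigD1 i)//= addrCA ltrDl ltr_pwDl// sumr_ge0//.
move=> sym; have [hs h0 PE] := polytope0P pP.
have Plin p x : p \in hs -> p.2 = 0 -> x \in W -> lin p.1 x <= 0.
  move=> ps p0 /(WC sym)[d d0]; rewrite PE => /(_ p ps).
  by rewrite /halfspace /= p0 linZ pmulr_rle0.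
suff [e e0 He] : exists2 e : R, 0 < e & {in hs, forall p : 'rV[R]_n * R, p.2 != 0 -> e * \sum_i `|p.1 0 i| <= p.2}.
  exists e => // x xe Wx; rewrite PE => p ps; rewrite /halfspace /=.
  have [p0|p0] := eqVneq p.2 0; first by rewrite p0 Plin.
  apply: le_trans (He p ps p0); rewrite linE mulr_sumr; apply: ler_sum => i _.
  by rewrite (le_trans (ler_norm _))// normrM mulrC ler_wpM2r// ltW.
elim: hs h0 {PE Plin} => [|p hs IH] h0; first by exists 1.
have [|e e0 He] := IH; first by move=> q qs; apply: h0; rewrite inE qs orbT.
have p0 := h0 p (mem_head _ _).
have s0 : 0 <= \sum_i `|p.1 0 i| by apply: sumr_ge0.
have [pz|pz] := eqVneq p.2 0.
  exists e => // q; rewrite inE => /orP[/eqP ->|/He//].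
  by rewrite pz eqxx.
exists (Num.min e (p.2 / (1 + \sum_i `|p.1 0 i|))).
  by rewrite lt_min e0 divr_gt0 ?lt_def ?pz//; lra.
move=> q; rewrite inE => /orP[/eqP -> _|/He H /H].
  apply: (@le_trans _ _ (p.2 / (1 + \sum_i `|p.1 0 i|) * \sum_i `|p.1 0 i|)).
    by rewrite ler_wpM2r// ge_min lexx orbT.
  rewrite mulrAC ler_pdivrMr; last lra.
  by rewrite ler_wpM2l//; lra.
by apply: le_trans; rewrite ler_wpM2r ?ge_min ?lexx// sumr_ge0.
Qed.


Definition relint_sign P : R := (-1) ^+ aff_dim P * \1_(relint P) (0 : V).

Lemma relint_sign_asym P : polytope0 P -> ~ symmetric_cone (cone_of P) -> relint_sign P = 0.
Proof.
move=> pP /(relint0P pP) nr; rewrite /relint_sign indicE memNset// mulr0//.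
Qed.

Lemma cone_of_vspace P : polytope0 P -> symmetric_cone (cone_of P) ->
  exists W : {vspace V}, cone_of P = [set` W].
Proof.
move=> pP sym; have [W [_ CW WC]] := polytope0_aff_hull pP.
by exists W; apply/seteqP; split=> x; [exact: CW|exact: WC].
Qed.

Lemma relint_sign_sym P (W : {vspace V}) : polytope0 P -> cone_of P = [set` W] ->
  relint_sign P = (-1) ^+ \dim W.
Proof.
move=> pP CW; have sym : symmetric_cone (cone_of P).
  by move=> x; rewrite CW /= memvN.
rewrite /relint_sign indicE mem_set; last exact/relint0P.
rewrite mulr1; have [W' [AE CW' WC]] := polytope0_aff_hull pP.
rewrite (aff_dimE AE) (_ : W' = W)//; apply/eqP; rewrite eqEsubv.
apply/andP; split; apply/subvP => x.
  by move=> /(WC sym); rewrite CW.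
by move=> xW; apply: CW'; rewrite CW.
Qed.

Lemma relint_sign_eq P Q : polytope0 P -> polytope0 Q -> cone_of P = cone_of Q ->
  relint_sign P = relint_sign Q.
Proof.
move=> pP pQ PQ; have [sym|asym] := pselect (symmetric_cone (cone_of P)).
  have [W PW] := cone_of_vspace pP sym.
  by rewrite (relint_sign_sym pP PW) (@relint_sign_sym Q W)// -PQ.
by rewrite !relint_sign_asym// -PQ.
Qed.

Lemma relint_sign_valuation : valuation (@polytope0 R n) relint_sign.
Proof.
move=> P Q pP pQ pI pU.
have UE := cone_ofU P Q; have IE := cone_ofI pP pQ.
(* For comparable cones, union and intersection have the same two cones as [P] and [Q]. *)
have [PQ|nPQ] := pselect (cone_of P `<=` cone_of Q).
  rewrite (relint_sign_eq (Q := Q) pU)//; last by rewrite UE; apply/setUidPr.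
  rewrite (relint_sign_eq (Q := P) pI)//; first by rewrite addrC.
  by rewrite IE; apply/setIidPl.
have [QP|nQP] := pselect (cone_of Q `<=` cone_of P).
  rewrite (relint_sign_eq (Q := P) pU)//; last by rewrite UE; apply/setUidPl.
  by rewrite (relint_sign_eq (Q := Q) pI)// IE; apply/setIidPr.
have [x [Cx Dx]] : exists x, cone_of P x /\ ~ cone_of Q x.
  by move/existsNP: nPQ => [x /not_implyP ?]; exists x.
have [y [Dy Cy]] : exists y, cone_of Q y /\ ~ cone_of P y.
  by move/existsNP: nQP => [y /not_implyP ?]; exists y.
have pC := polyhedral_cone_of pP; have pD := polyhedral_cone_of pQ.
have CUD u v : cone_of P u -> cone_of Q v -> (cone_of P `|` cone_of Q) (u + v).
  rewrite -UE => Cu Dv; apply: (coneD (polyhedral_cone_of pU)); rewrite UE; [by left|by right].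
have [asP asQ] := incomparable_not_symmetric pC pD CUD Cx Dx Dy Cy.
rewrite (relint_sign_asym pP asP) (relint_sign_asym pQ asQ) addr0.
have UI := symmetric_coneUI pC pD CUD Cx Dx Dy Cy; rewrite -UE -IE in UI.
have [symU|asymU] := pselect (symmetric_cone (cone_of (P `|` Q))); last first.
  by rewrite !relint_sign_asym ?addr0// -UI.
have [WU WUE] := cone_of_vspace pU symU.
have [WI WIE] := cone_of_vspace pI (UI.1 symU).
rewrite (relint_sign_sym pU WUE) (relint_sign_sym pI WIE).
rewrite UE in WUE; rewrite IE in WIE.
(* The dimensions differ by one, so the two signs cancel. *)
rewrite (dim_coneU pC pD CUD Cx Dx Dy Cy WUE WIE) exprS.
by rewrite mulN1r addNr.
Qed.

Lemma mulmx_polytope0 (A : 'M[R]_n) P : polytope0 P -> polytope0 (mulmx A @` P).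
Proof.
move=> [/polytopeE[s sE] P0]; split; last by exists 0; rewrite ?mulmx0.
apply/polytopeE; exists [seq A *m v | v <- s]; rewrite sE; apply/seteqP; split.
  by move=> _ [x sx <-]; exact: hull_mulmx.
by move=> y /hull_map_mulmx[x sx <-]; exists x.
Qed.

Lemma relint_sign_SL : SL_invariant (@polytope0 R n) relint_sign.
Proof.
move=> A P detA pP.
have Au : A \in unitmx by rewrite unitmxE detA unitr1.
have pAP := mulmx_polytope0 A pP.
have CE x : cone_of (mulmx A @` P) (A *m x) <-> cone_of P x.
  split=> -[e e0].
    move=> [y Py]; rewrite scalemxAr => /(can_inj (mulKmx Au)) E.
    by exists e; rewrite // -E.
  by move=> Px; exists e => //; exists (e *: x); rewrite ?scalemxAr.
have [sym|asym] := pselect (symmetric_cone (cone_of P)); last first.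
  rewrite !relint_sign_asym// => sym; apply: asym => x /CE Cx.
  by apply/CE; rewrite mulmxN; exact: sym.
have [W WE] := cone_of_vspace pP sym.
pose f : 'End(V) := linfun (mulmx A).
have fE x : f x = A *m x by rewrite lfunE.
rewrite (relint_sign_sym pP WE) (@relint_sign_sym _ (f @: W)%VS)//.
  congr (_ ^+ _); apply: limg_dim_eq; apply/eqP; rewrite -subv0; apply/subvP => x.
  rewrite memv_cap memv_ker fE memv0 => /andP[_ /eqP Ax].
  by rewrite -(mulKmx Au x) Ax mulmx0.
apply/seteqP; split=> y.
  rewrite -[y](mulKVmx Au) => /CE; rewrite WE /= => yW.
  by rewrite -fE; exact: memv_img.
by move=> /= /memv_imgP[x xW ->]; rewrite fE; apply/CE; rewrite WE.
Qed.

End relint_functional.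

(** * Classification *)

Section classification.
Context (R : realType) (n : nat).
Local Notation V := 'cV[R]_n.
Implicit Types (P Q : set V) (s r : seq V) (u v w : V) (a b c d e t : R).

Definition standard_functional (c0 c0' : R) (psi : R -> R) P : R :=
  c0 * euler_char P + c0' * (-1) ^+ aff_dim P * \1_(relint P) (0 : V) + psi (volume P).

Lemma standard_functionalE c0 c0' psi P : polytope0 P ->
  standard_functional c0 c0' psi P = c0 + c0' * relint_sign P + psi (volume P).
Proof.
move=> [_ P0]; rewrite /standard_functional /euler_char asboolT ?mulr1 ?mulrA//.
by exists 0.
Qed.

Lemma standard_functional_valuation c0 c0' psi : cauchy_solution psi ->
  valuation (@polytope0 R n) (standard_functional c0 c0' psi).
Proof.
move=> psiD P Q pP pQ pI pU; rewrite !standard_functionalE//.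
have /(congr1 psi) := volume_valuation pP pQ pI pU; rewrite !psiD ?volume_ge0// => E.
have := relint_sign_valuation pP pQ pI pU => /(congr1 (fun z => c0' * z)).
rewrite !mulrDr; lra.
Qed.

Lemma standard_functional_SL c0 c0' psi :
  SL_invariant (@polytope0 R n) (standard_functional c0 c0' psi).
Proof.
move=> A P detA pP; rewrite !standard_functionalE//; last exact: mulmx_polytope0.
by rewrite relint_sign_SL// volume_SL.
Qed.

Lemma free_size s : free s -> (size s <= n)%N.
Proof.
rewrite /free => /eqP <-; have := dimvS (subvf << s >>%VS).
by rewrite dimvf /dim /= muln1.
Qed.

Lemma relint_sign_nil : relint_sign (simplex [::] : set V) = 1.
Proof.
rewrite (@relint_sign_sym _ _ _ 0%VS) ?dimv0//; first exact: polytope0_simplex.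
rewrite simplex_nil; apply/seteqP; split=> x.
  by move=> [e e0 /= /eqP]; rewrite scaler_eq0 gt_eqF// memv0.
by rewrite /= memv0 => /eqP ->; exists 1; rewrite //= scaler0.
Qed.

(** The cone contains [v] but not [- v]: a multiple [- e *: v] in the simplex would put
    [(e + a) *: v] in the span of [s]. *)
Lemma relint_sign_simplex v s : free (v :: s) -> relint_sign (simplex (v :: s)) = 0.
Proof.
rewrite free_cons => /andP[vs _]; apply: relint_sign_asym; first exact: polytope0_simplex.
move=> /(_ v)[]; first by apply: sub_cone_of; apply: hull_mem; rewrite !inE eqxx orbT.
move=> e e0 /simplexP[c _ [a a0 /hull_span]].
rewrite scalerN -opprD memvN -scalerDl rpredZeq (negbTE vs) orbF gt_eqF//; lra.
Qed.

(** Volume is itself an invariant valuation, so [simplex_low_const] reduces a nonempty [s] to one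
    segment inside a coordinate hyperplane. *)
Lemma volume_simplex_low s : (1 < n)%N -> free s -> (size s < n)%N -> volume (simplex s) = 0.
Proof.
move=> n1; have n0 : (0 < n)%N by exact: ltnW.
have flat s' : (forall v, v \in s' -> v (Ordinal n1) 0 = 0) -> volume (simplex s') = 0.
  move=> H; apply: (@volume_coordinate_hyperplane _ _ (Ordinal n1)) => [|x].
    by case: (polytope0_simplex s').
  pose l : 'rV[R]_n := delta_mx 0 (Ordinal n1).
  have l0 v : v \in 0 :: s' -> lin l v = 0.
    by rewrite lin_delta inE => /orP[/eqP ->|/H//]; rewrite mxE.
  have le0 : {in 0 :: s', forall v, lin l v <= 0} by move=> v /l0 ->.
  have ge0 : {in 0 :: s', forall v, 0 <= lin l v} by move=> v /l0 ->.
  move=> sx; have := hull_lin_le le0 sx; have := hull_lin_ge ge0 sx.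
  by rewrite lin_delta !mul0r => A B; apply/eqP; rewrite eq_le A B.
case: s => [_ _|v s vsfree sn]; first by apply: flat.
rewrite (@simplex_low_const _ _ _ (@volume_valuation R n) (@volume_SL R n) _ (delta_mx (Ordinal n0) 0))//.
  by apply: flat => u; rewrite inE => /eqP ->; rewrite mxE.
apply/eqP => /colP/(_ (Ordinal n0)); rewrite !mxE !eqxx => /eqP.
by rewrite oner_eq0.
Qed.

(** By [simplex_cauchy] the volume is additive in the determinant, and being nonnegative it is
    linear. The constant is not computed; it is positive because the standard simplex has positive
    volume. *)
Lemma volume_simplex_full (e : V) r : (1 < n)%N -> free (e :: r) -> size (e :: r) = n ->
  dets (e :: r) = 1 -> exists2 k, 0 < k &
  forall s, free s -> size s = n -> volume (simplex s) = k * `|dets s|.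
Proof.
move=> n1 efree en e1; pose g t := volume (simplex (t *: e :: r)).
have e0 : e != 0 by apply: (free_not0 efree); rewrite mem_head.
have gD a b : 0 < a -> 0 < b -> g (a + b) = g a + g b.
  move=> a0 b0; rewrite /g.
  have := simplex_cauchy n1 (@volume_valuation R n) (@volume_SL R n) efree en e0 e1 a0 b0.
  by rewrite (@volume_simplex_low [:: e]) ?addr0// seq1_free.
have gE := additive_ge0_linear gD (fun a _ => volume_ge0 _).
have volE s : free s -> size s = n -> volume (simplex s) = g 1 * `|dets s|.
  move=> sfree sn.
  rewrite (simplex_full n1 (@volume_SL R n) sfree sn efree en e1) -/(g _).
  by rewrite gE ?normr_gt0 ?free_dets// mulrC.
exists (g 1) => //.
have := @volume_simplex_delta_gt0 R n (ltnW n1).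
have dfree := @free_delta_enum R n.
have dsize : size [seq delta_mx i 0 : V | i <- enum 'I_n] = n.
  by rewrite size_map size_enum_ord.
by rewrite (volE _ dfree dsize) pmulr_lgt0// normr_gt0 free_dets.
Qed.

Lemma SL_valuation_standard (Psi : set V -> R) : (1 < n)%N ->
  valuation (@polytope0 R n) Psi -> SL_invariant (@polytope0 R n) Psi ->
  exists c0 c0' psi, cauchy_solution psi /\
    forall P, polytope0 P -> Psi P = standard_functional c0 c0' psi P.
Proof.
move=> n1 Pval PSL.
(* Extending the empty list provides a reference basis of determinant 1. *)
have [|[|e r] []] := @free_extend R n [::] (nil_free _).
- exact: ltnW.
- by move=> /= n_eq0; exfalso; have := ltnW n1; rewrite -n_eq0.
move=> en efree e1.
have e0 : e != 0 by apply: (free_not0 efree); rewrite mem_head.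
have [k k0 volE] := volume_simplex_full n1 efree en e1.
pose c0 := Psi (simplex [:: e]).
pose F t := Psi (simplex (t *: e :: r)) - c0.
(* Division by [k] converts volume into determinant; the guard gives [psi 0 = 0], as Cauchy's
   equation requires. *)
pose psi x := if 0 < x then F (x / k) else 0.
have psiD : cauchy_solution psi.
  move=> x y; rewrite le_eqVlt => /orP[/eqP <- _|x0].
    by rewrite add0r /psi ltxx add0r.
  rewrite le_eqVlt => /orP[/eqP <-|y0].
    by rewrite addr0 /psi ltxx addr0.
  rewrite /psi x0 y0 addr_gt0// mulrDl /F.
  have := simplex_cauchy n1 Pval PSL efree en e0 e1 (divr_gt0 x0 k0) (divr_gt0 y0 k0).
  rewrite -/c0; lra.
(* The second constant is forced by the value at the point 0, where the relative interior term is 1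
   and the volume is 0. *)
exists c0, (Psi (simplex [::]) - c0), psi; split=> // P pP.
set G := standard_functional _ _ _.
apply/eqP; rewrite -subr_eq0; apply/eqP.
apply: (@valuation_vanish _ _ (fun P => Psi P - G P)) => //.
  move=> A B pA pB pI pU; have := Pval _ _ pA pB pI pU.
  have := standard_functional_valuation c0 (Psi (simplex [::]) - c0) psiD pA pB pI pU.
  rewrite -/G; lra.
move=> s sfree; rewrite /G standard_functionalE; last exact: polytope0_simplex.
case: s sfree => [_|v s vsfree].
  rewrite relint_sign_nil volume_simplex_low ?nil_free ?(ltnW n1)//.
  by rewrite /psi ltxx; ring.
rewrite relint_sign_simplex// mulr0 addr0.
have := free_size vsfree; rewrite leq_eqVlt => /orP[/eqP vsn|vsn]; last first.
  rewrite volume_simplex_low// /psi ltxx addr0.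
  by rewrite (simplex_low_const Pval PSL vsfree _ e0) ?subrr.
have d0 : 0 < `|dets (v :: s)| by rewrite normr_gt0 free_dets.
rewrite volE// /psi mulr_gt0// mulrAC divff ?gt_eqF// mul1r /F.
by rewrite (simplex_full n1 PSL vsfree vsn efree en e1); ring.
Qed.

End classification.

Theorem theorem1 (R : realType) (n : nat) (hn : (2 <= n)%N)
    (Psi : set 'cV[R]_n -> R) :
  (valuation (@polytope0 R n) Psi /\ SL_invariant (@polytope0 R n) Psi) <->
  exists (c0 c0' : R) (psi : R -> R),
    cauchy_solution psi /\
    forall P : set 'cV[R]_n, polytope0 P ->
      Psi P = c0 * euler_char P
              + c0' * (-1) ^+ aff_dim P * \1_(relint P) (0 : 'cV[R]_n)
              + psi (volume P).
Proof.
split=> [[Pval PSL]|[c0 [c0' [psi [psiD PE]]]]].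
  exact: SL_valuation_standard.
have {}PE P : polytope0 P -> Psi P = standard_functional c0 c0' psi P by exact: PE.
split=> [P Q pP pQ pI pU|A P detA pP].
  by rewrite !PE//; exact: standard_functional_valuation.
rewrite !PE//; last exact: mulmx_polytope0.
exact: standard_functional_SL.
Qed.
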